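(* Let $H$ be a finite dimensional Hopf algebra with invertible antipode $S$ over a field $k$ of characteristic $0$. Then the functor $\widehat{(-)}:\mathcal{M}^H\to\widehat{\mathcal{M}^H}$, $M\mapsto\mathrm{Hom}(H,M)^H$, from right $H$-comodules to right $H$-contramodules is an equivalence, and so is the functor $\widehat{(-)}_H$ from anti-Yetter-Drinfeld modules to anti-Yetter-Drinfeld contramodules over $H$.
   Context: Sweedler notation: $\Delta(h)=h^1\otimes h^2$; a right coaction is $m\mapsto m_0\otimes m_1$. $\mathrm{Hom}$ denotes $k$-linear maps, $\mathrm{Hom}(-,-)^H$ right $H$-comodule maps; $f(a-b)$ means $x\mapsto f(axb)$. A right $H$-contramodule is a vector space $N$ with linear $\alpha:\mathrm{Hom}(H,N)\to N$ such that $\alpha(x\mapsto\alpha(h\mapsto f(x\otimes h)))=\alpha(h\mapsto f(h^1\otimes h^2))$ for $f\in\mathrm{Hom}(H\otimes H,N)$ and $\alpha(h\mapsto\epsilon(h)n)=n$. For a comodule $M$, $\widehat{M}=\mathrm{Hom}(H,M)^H$ has contraaction $(\alpha\theta)(h)=\theta_{h^1}(h^2)$ for $\theta:h\mapsto\theta_h$. Anti-Yetter-Drinfeld ($aYD$) module: left $H$-module and right $H$-comodule $M$ with $(hm)_0\otimes(hm)_1=h^2m_0\otimes h^3m_1S(h^1)$. $aYD$-contramodule: left $H$-module and right $H$-contramodule $N$ with $h\alpha(f)=\alpha(h^2f(S(h^3)-h^1))$. Morphisms preserve both structures. For an $aYD$-module $M$, $\widehat{M}_H$ is $\widehat{M}=\mathrm{Hom}(H,M)^H$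 with contraaction $(\alpha\theta)(h)=\theta_{h^1}(h^2)$ and $H$-action $(h\cdot\phi)(-)=h^2\phi(S(h^3)-h^1)$. *)

(* Defs.v *)
From HB Require Import structures.
From mathcomp Require Import all_boot all_algebra falgebra.
From mathcomp Require Import boolp.

Set Implicit Arguments.
Unset Strict Implicit.
Unset Printing Implicit Defensive.

Import GRing.Theory.
Local Open Scope ring_scope.
Local Open Scope quotient_scope.

Section LinearMaps.
Variables (k : fieldType) (U V : lmodType k).

Definition mklin (f : U -> V) (Lf : linear f) : {linear U -> V} :=
  HB.pack f (GRing.isLinear.Build k U V *:%R f Lf).

Lemma linear_ext (f g : {linear U -> V}) : f =1 g -> f = g.
Proof.
case: f g => [f [[[f0 fD]] [fZ]]] [g [[[g0 gD]] [gZ]]] /= /funext efg.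
move: f0 fD fZ; rewrite efg => f0 fD fZ.
by rewrite (Prop_irrelevance f0 g0) (Prop_irrelevance fD gD)
  (Prop_irrelevance fZ gZ).
Qed.

HB.instance Definition _ := gen_eqMixin {linear U -> V}.
HB.instance Definition _ := gen_choiceMixin {linear U -> V}.

Definition lin0 : {linear U -> V} := \0.
Definition linopp (f : {linear U -> V}) : {linear U -> V} := \- f.
Definition linadd (f g : {linear U -> V}) : {linear U -> V} := f \+ g.

Fact linscale_subproof (a : k) (f : {linear U -> V}) :
  linear (fun x => a *: f x).
Proof. by move=> c x y; rewrite linearP scalerDr !scalerA mulrC. Qed.
Definition linscale a f := mklin (linscale_subproof a f).

Fact linaddA : associative linadd.
Proof. by move=> f g h; apply: linear_ext => x /=; rewrite addrA. Qed.
Fact linaddC : commutative linadd.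
Proof. by move=> f g; apply: linear_ext => x /=; rewrite addrC. Qed.
Fact linadd0 : left_id lin0 linadd.
Proof. by move=> f; apply: linear_ext => x /=; rewrite add0r. Qed.
Fact linaddN : left_inverse lin0 linopp linadd.
Proof. by move=> f; apply: linear_ext => x /=; rewrite addNr. Qed.
HB.instance Definition _ :=
  GRing.isZmodule.Build {linear U -> V} linaddA linaddC linadd0 linaddN.

Fact linscaleA a b f : linscale a (linscale b f) = linscale (a * b) f.
Proof. by apply: linear_ext => x /=; rewrite scalerA. Qed.
Fact linscale1 : left_id 1 linscale.
Proof. by move=> f; apply: linear_ext => x /=; rewrite scale1r. Qed.
Fact linscaleDr : right_distributive linscale +%R.
Proof. by move=> a f g; apply: linear_ext => x /=; rewrite scalerDr. Qed.
Fact linscaleDl f : {morph linscale^~ f : a b / a + b}.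
Proof. by move=> a b; apply: linear_ext => x /=; rewrite scalerDl. Qed.
HB.instance Definition _ := GRing.Zmodule_isLmodule.Build k {linear U -> V}
  linscaleA linscale1 linscaleDr linscaleDl.

Lemma lin_addE (f g : {linear U -> V}) x : (f + g) x = f x + g x.
Proof. by []. Qed.
Lemma lin_scaleE a (f : {linear U -> V}) x : (a *: f) x = a *: f x.
Proof. by []. Qed.

End LinearMaps.

Section Tensor.
Variables (k : fieldType) (U V : lmodType k).

(* Tensors are formal finite sums of pairs, two of them being identified when
   all bilinear maps agree on them; the universal property is given by tsum_tens,
   tsum_linear and tensor_lin_ext below. *)
Definition tens_rel (s t : seq (U * V)) : bool :=
  `[< forall (W : lmodType k) (b : {bilinear U -> V -> W}),
        \sum_(p <- s) b p.1 p.2 = \sum_(p <- t) b p.1 p.2 >].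

Fact tens_rel_refl : reflexive tens_rel.
Proof. by move=> s; apply/asboolP. Qed.
Fact tens_rel_sym : symmetric tens_rel.
Proof.
by move=> s t; apply/asboolP/asboolP => e W b; rewrite e.
Qed.
Fact tens_rel_trans : transitive tens_rel.
Proof.
by move=> s t u /asboolP e /asboolP e'; apply/asboolP => W b; rewrite e e'.
Qed.
Canonical tens_equiv :=
  EquivRel tens_rel tens_rel_refl tens_rel_sym tens_rel_trans.

Definition tensor := {eq_quot tens_rel}.
HB.instance Definition _ := Quotient.on tensor.
HB.instance Definition _ := Choice.on tensor.

Definition tens (u : U) (v : V) : tensor := \pi_tensor [:: (u, v)].
Definition tens0 : tensor := \pi_tensor [::].
Definition tensD (x y : tensor) : tensor := \pi_tensor (repr x ++ repr y).
Definition tensZ (a : k) (x : tensor) : tensor :=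
  \pi_tensor [seq (a *: p.1, p.2) | p <- repr x].

(* Sweedler-style sums: \tsum_(a, b <- t) F a b is the value at t of the linear
   map induced by F.  It is computed on a chosen representative of t, so it is
   meaningful only when F is bilinear in (a, b), as in all uses below. *)
Definition tsum (W : lmodType k) (t : tensor) (b : U -> V -> W) : W :=
  \sum_(p <- repr t) b p.1 p.2.

Lemma tens_piP (s t : seq (U * V)) :
  (forall (W : lmodType k) (b : {bilinear U -> V -> W}),
    \sum_(p <- s) b p.1 p.2 = \sum_(p <- t) b p.1 p.2) <->
  \pi_tensor s = \pi_tensor t.
Proof.
split=> [e|/eqmodP/asboolP//]; by apply/eqmodP/asboolP.
Qed.

Lemma tsum_pi (W : lmodType k) s (b : {bilinear U -> V -> W}) :
  tsum (\pi_tensor s) b = \sum_(p <- s) b p.1 p.2.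
Proof. by move: W b; apply/tens_piP; rewrite reprK. Qed.

Lemma tensP (x y : tensor) :
  (forall (W : lmodType k) (b : {bilinear U -> V -> W}), tsum x b = tsum y b)
  -> x = y.
Proof. by move=> e; rewrite -[x]reprK -[y]reprK; apply/tens_piP. Qed.

Lemma tsum_tensD (W : lmodType k) x y (b : {bilinear U -> V -> W}) :
  tsum (tensD x y) b = tsum x b + tsum y b.
Proof. by rewrite tsum_pi big_cat. Qed.
Lemma tsum_tensZ (W : lmodType k) a x (b : {bilinear U -> V -> W}) :
  tsum (tensZ a x) b = a *: tsum x b.
Proof.
rewrite tsum_pi big_map scaler_sumr; apply: eq_bigr => p _ /=.
exact: linearZl_LR.
Qed.
Lemma tsum_tens0 (W : lmodType k) (b : {bilinear U -> V -> W}) :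
  tsum tens0 b = 0.
Proof. by rewrite tsum_pi big_nil. Qed.

Fact tensDA : associative tensD.
Proof. by move=> x y z; apply: tensP => W b; rewrite !tsum_tensD addrA. Qed.
Fact tensDC : commutative tensD.
Proof. by move=> x y; apply: tensP => W b; rewrite !tsum_tensD addrC. Qed.
Fact tensD0 : left_id tens0 tensD.
Proof.
by move=> x; apply: tensP => W b; rewrite tsum_tensD tsum_tens0 add0r.
Qed.
Fact tensDN : left_inverse tens0 (tensZ (-1)) tensD.
Proof.
move=> x; apply: tensP => W b.
by rewrite tsum_tensD tsum_tens0 tsum_tensZ scaleN1r addNr.
Qed.
HB.instance Definition _ := GRing.isZmodule.Build tensor
  tensDA tensDC tensD0 tensDN.

Fact tensZA a b x : tensZ a (tensZ b x) = tensZ (a * b) x.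
Proof. by apply: tensP => W f; rewrite !tsum_tensZ scalerA. Qed.
Fact tensZ1 : left_id 1 tensZ.
Proof. by move=> x; apply: tensP => W f; rewrite !tsum_tensZ scale1r. Qed.
Fact tensZDr : right_distributive tensZ +%R.
Proof.
move=> a x y; apply: tensP => W f.
by rewrite !(tsum_tensZ, tsum_tensD) scalerDr.
Qed.
Fact tensZDl x : {morph tensZ^~ x : a b / a + b}.
Proof.
move=> a b; apply: tensP => W f.
by rewrite !(tsum_tensZ, tsum_tensD) scalerDl.
Qed.
HB.instance Definition _ := GRing.Zmodule_isLmodule.Build k tensor
  tensZA tensZ1 tensZDr tensZDl.

End Tensor.

Reserved Notation "u ⊗ v" (at level 45, left associativity).
Reserved Notation "\tsum_ ( a , b <- t ) F"
  (at level 46, F at level 46, a name, b name, t at level 60,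
   format "'[' \tsum_ ( a ,  b  <-  t ) '/  '  F ']'").
Notation "u ⊗ v" := (tens u v) : ring_scope.
Notation "\tsum_ ( a , b <- t ) F" := (tsum t (fun a b => F)) : ring_scope.

Section TensorTheory.
Variables (k : fieldType) (U V W : lmodType k).

Definition bilin (b : U -> V -> W) : Prop :=
  (forall v, linear (fun u => b u v)) /\ (forall u, linear (b u)).

Definition mkbilin (b : U -> V -> W) (Bb : bilin b) : {bilinear U -> V -> W} :=
  HB.pack b (bilinear_isBilinear.Build k U V W *:%R *:%R b
    (proj1 Bb, proj2 Bb)).

Lemma bilinear_bilin (b : {bilinear U -> V -> W}) : bilin b.
Proof.
split=> [v|u] a x y; last exact: linearPr.
exact: linearPl.
Qed.

End TensorTheory.

Section TensorTheory2.
Variables (k : fieldType).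
Implicit Types U V W X : lmodType k.

Lemma tsum_tens U V W (u : U) (v : V) (b : U -> V -> W) :
  bilin b -> tsum (u ⊗ v) b = b u v.
Proof. by move=> Bb; rewrite (tsum_pi _ (mkbilin Bb)) big_seq1. Qed.

Lemma tsum_linear U V W (b : U -> V -> W) :
  bilin b -> linear (fun t : tensor U V => tsum t b).
Proof.
move=> Bb a x y; rewrite -(tsum_tensZ _ _ (mkbilin Bb)).
exact: (tsum_tensD _ _ (mkbilin Bb)).
Qed.

Lemma eq_tsum U V W (t : tensor U V) (b c : U -> V -> W) :
  (forall u v, b u v = c u v) -> tsum t b = tsum t c.
Proof. by move=> e; apply: eq_bigr. Qed.

Lemma linear_tsum U V X W (f : {linear X -> W}) (t : tensor U V) b :
  f (tsum t b) = tsum t (fun u v => f (b u v)).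
Proof. exact: linear_sum. Qed.

Lemma linf_tsum U V X W (f : X -> W) (t : tensor U V) b : linear f ->
  f (tsum t b) = tsum t (fun u v => f (b u v)).
Proof. by move=> Lf; exact: (linear_tsum (mklin Lf)). Qed.

Lemma tsumD U V W (t : tensor U V) (b c : U -> V -> W) :
  tsum t (fun u v => b u v + c u v) = tsum t b + tsum t c.
Proof. exact: big_split. Qed.

Lemma tsumZ U V W (t : tensor U V) (b : U -> V -> W) a :
  tsum t (fun u v => a *: b u v) = a *: tsum t b.
Proof. by rewrite /tsum scaler_sumr. Qed.

Lemma exchange_tsum U V U' V' W (t : tensor U V) (t' : tensor U' V')
    (F : U -> V -> U' -> V' -> W) :
  tsum t (fun u v => tsum t' (F u v)) =
  tsum t' (fun u' v' => tsum t (fun u v => F u v u' v')).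
Proof. exact: exchange_big. Qed.

Lemma tsum_tsum U V U' V' W (t : tensor U V) (G : U -> V -> tensor U' V')
    (b : U' -> V' -> W) : bilin b ->
  tsum (tsum t G) b = tsum t (fun u v => tsum (G u v) b).
Proof. by move=> Bb; exact: (linear_tsum (mklin (tsum_linear Bb))). Qed.

Lemma lin_id X : linear (fun x : X => x).
Proof. by []. Qed.
Lemma lin_comp X U V (f : {linear U -> V}) (g : X -> U) :
  linear g -> linear (fun x => f (g x)).
Proof. by move=> Lg a x y; rewrite Lg linearP. Qed.
Lemma lin_compf X U V (f : U -> V) (g : X -> U) :
  linear f -> linear g -> linear (fun x => f (g x)).
Proof. by move=> Lf Lg a x y; rewrite Lg Lf. Qed.
Lemma lin_ev X U V (g : X -> {linear U -> V}) u :
  linear g -> linear (fun x => g x u).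
Proof. by move=> Lg a x y; rewrite Lg. Qed.
Lemma tens_bilin U V : bilin (@tens k U V).
Proof.
split=> [v|u] a x y; apply: tensP => W b;
  rewrite (tsum_linear (bilinear_bilin b)) !tsum_tens; try exact: bilinear_bilin.
  exact: linearPl.
exact: linearPr.
Qed.
Lemma lin_tensl X U V (g : X -> U) (v : V) :
  linear g -> linear (fun x => g x ⊗ v).
Proof. by move=> Lg a x y; rewrite Lg (proj1 (tens_bilin U V)). Qed.
Lemma lin_tensr X U V (g : X -> V) (u : U) :
  linear g -> linear (fun x => u ⊗ g x).
Proof. by move=> Lg a x y; rewrite Lg (proj2 (tens_bilin U V)). Qed.
Lemma lin_bill X U V W (b : {bilinear U -> V -> W}) (g : X -> U) (v : V) :
  linear g -> linear (fun x => b (g x) v).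
Proof. by move=> Lg a x y; rewrite Lg (proj1 (bilinear_bilin b)). Qed.
Lemma lin_bilr X U V W (b : {bilinear U -> V -> W}) (g : X -> V) (u : U) :
  linear g -> linear (fun x => b u (g x)).
Proof. by move=> Lg a x y; rewrite Lg (proj2 (bilinear_bilin b)). Qed.
Lemma lin_tsum X U V W (t : tensor U V) (F : X -> U -> V -> W) :
  (forall u v, linear (fun x => F x u v)) -> linear (fun x => tsum t (F x)).
Proof.
move=> LF a x y; rewrite -tsumZ -tsumD; apply: eq_tsum => u v; exact: LF.
Qed.
Lemma lin_tsumt X U V W (g : X -> tensor U V) (F : U -> V -> W) :
  linear g -> bilin F -> linear (fun x => tsum (g x) F).
Proof. by move=> Lg /tsum_linear LF a x y; rewrite Lg LF. Qed.
Lemma lin_mull X (A : algType k) (g : X -> A) c :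
  linear g -> linear (fun x => g x * c).
Proof. by move=> Lg a x y; rewrite Lg mulrDl scalerAl. Qed.
Lemma lin_mulr X (A : algType k) (g : X -> A) c :
  linear g -> linear (fun x => c * g x).
Proof. by move=> Lg a x y; rewrite Lg mulrDr scalerAr. Qed.
Lemma lin_scalel X U V (f : {scalar U}) (g : X -> U) (v : V) :
  linear g -> linear (fun x => f (g x) *: v).
Proof. by move=> Lg a x y; rewrite Lg linearP scalerDl scalerA. Qed.
Lemma lin_scaler X V (g : X -> V) (c : k) :
  linear g -> linear (fun x => c *: g x).
Proof. by move=> Lg a x y; rewrite Lg scalerDr !scalerA mulrC. Qed.

Lemma tensor_tsum U V (t : tensor U V) : t = \tsum_(a, b <- t) (a ⊗ b) :> tensor U V.
Proof.
apply: tensP => W b; rewrite tsum_tsum; last exact: bilinear_bilin.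
by apply: eq_tsum => u v; rewrite tsum_tens//; exact: bilinear_bilin.
Qed.

Lemma tensor_lin_ext U V W (f g : tensor U V -> W) : linear f -> linear g ->
  (forall u v, f (u ⊗ v) = g (u ⊗ v)) -> f =1 g.
Proof.
move=> Lf Lg e t; rewrite (tensor_tsum t) !linf_tsum//.
by apply: eq_tsum => u v.
Qed.

End TensorTheory2.

Ltac lin_step :=
  cbv beta;
  match goal with
  | |- bilin _ => split=> ?
  | |- forall _, _ => move=> ?
  | |- _ /\ _ => split
  | |- GRing.linear_for _ (fun x => x) => apply: lin_id
  | BF : bilin ?F |- GRing.linear_for _ (fun x => ?F (@?g x) ?v) =>
      apply: (@lin_compf _ _ _ _ (fun u => F u v) g (proj1 BF v))
  | BF : bilin ?F |- GRing.linear_for _ (fun x => ?F ?u (@?g x)) =>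
      apply: (@lin_compf _ _ _ _ (F u) g (proj2 BF u))
  | LF : GRing.linear_for _ ?F |- GRing.linear_for _ (fun x => ?F (@?g x)) =>
      apply: (@lin_compf _ _ _ _ F g LF)
  | |- GRing.linear_for _ (fun x => tens (@?g x) ?v) => apply: (@lin_tensl _ _ _ _ g v)
  | |- GRing.linear_for _ (fun x => tens ?u (@?g x)) => apply: (@lin_tensr _ _ _ _ g u)
  | |- GRing.linear_for _ (tens _) => apply: (proj2 (tens_bilin _ _))
  | |- GRing.linear_for _ (fun x => tsum ?t (@?F x)) => apply: (@lin_tsum _ _ _ _ _ t F)
  | |- GRing.linear_for _ (fun x => tsum (@?g x) ?F) => apply: (@lin_tsumt _ _ _ _ _ g F)
  | |- GRing.linear_for _ (fun x => @GRing.mul _ (@?g x) ?c) => apply: (@lin_mull _ _ _ g c)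
  | |- GRing.linear_for _ (fun x => @GRing.mul _ ?c (@?g x)) => apply: (@lin_mulr _ _ _ g c)
  | |- GRing.linear_for _ (fun x => @GRing.scale _ _ (GRing.Linear.sort ?f (@?g x)) ?v) => apply: (@lin_scalel _ _ _ _ f g v)
  | |- GRing.linear_for _ (fun x => @GRing.scale _ _ ?c (@?g x)) => apply: (@lin_scaler _ _ _ g c)
  | |- GRing.linear_for _ (fun x => Bilinear.sort ?b (@?g x) ?v) => apply: (@lin_bill _ _ _ _ _ b g v)
  | |- GRing.linear_for _ (fun x => Bilinear.sort ?b ?u (@?g x)) => apply: (@lin_bilr _ _ _ _ _ b g u)
  | |- GRing.linear_for _ (fun x => GRing.Linear.sort ?f (@?g x)) => apply: (@lin_comp _ _ _ _ f g)
  | |- GRing.linear_for _ (fun x => GRing.Linear.sort (@?g x) ?u) => apply: (@lin_ev _ _ _ _ g u)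
  | |- GRing.linear_for _ _ => first [assumption | exact: linearP]
  end.
Ltac lin := repeat lin_step.

Record hopf (k : fieldType) (H : algType k) := Hopf {
  comul : {linear H -> tensor H H};
  counit : {scalar H};
  antipode : {linear H -> H};
  comulA : forall h,
    \tsum_(a, b <- comul h) \tsum_(a1, a2 <- comul a) (a1 ⊗ (a2 ⊗ b)) =
    \tsum_(a, b <- comul h) \tsum_(b1, b2 <- comul b) (a ⊗ (b1 ⊗ b2));
  counitl : forall h, \tsum_(a, b <- comul h) (counit a *: b) = h;
  counitr : forall h, \tsum_(a, b <- comul h) (counit b *: a) = h;
  comul1 : comul 1 = 1 ⊗ 1;
  comulM : forall g h, comul (g * h) =
    \tsum_(g1, g2 <- comul g) \tsum_(h1, h2 <- comul h) (g1 * h1 ⊗ g2 * h2);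
  counit1 : counit 1 = 1;
  counitM : forall g h, counit (g * h) = counit g * counit h;
  antipodel : forall h,
    \tsum_(a, b <- comul h) (antipode a * b) = counit h *: 1;
  antipoder : forall h,
    \tsum_(a, b <- comul h) (a * antipode b) = counit h *: 1 }.

Section HopfTheory.
Variables (k : fieldType) (H : algType k) (A : hopf H).
Implicit Types (M N W : lmodType k) (g h x : H).
Local Notation Δ := (comul A).
Local Notation ε := (counit A).
Local Notation S := (antipode A).

Definition trilin W (F : H -> H -> H -> W) : Prop :=
  [/\ forall b c, linear (fun a => F a b c),
      forall a c, linear (fun b => F a b c)
    & forall a b, linear (fun c => F a b c)].

Lemma swA W h (F : H -> H -> H -> W) : trilin F ->
  \tsum_(a, b <- Δ h) \tsum_(a1, a2 <- Δ a) F a1 a2 b =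
  \tsum_(a, b <- Δ h) \tsum_(b1, b2 <- Δ b) F a b1 b2.
Proof.
move=> [F1 F2 F3].
have B2 a : bilin (F a) by split.
have B : bilin (fun a t => tsum t (F a)).
  by split=> [t|a]; [apply: lin_tsum => u v; exact: F1|exact: tsum_linear].
have := congr1 (fun t => tsum t (fun a s => tsum s (F a))) (comulA A h).
rewrite !tsum_tsum// => E; move: E.
have -> : tsum (Δ h) (fun a b => tsum (tsum (Δ a) (fun a1 a2 => a1 ⊗ (a2 ⊗ b)))
   (fun a s => tsum s (F a))) =
   \tsum_(a, b <- Δ h) \tsum_(a1, a2 <- Δ a) F a1 a2 b.
  apply: eq_tsum => a b; rewrite tsum_tsum//; apply: eq_tsum => a1 a2.
  by rewrite !tsum_tens.
move=> ->; apply: eq_tsum => a b; rewrite tsum_tsum//; apply: eq_tsum => b1 b2.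
by rewrite !tsum_tens.
Qed.

Lemma sw_counitl W h (F : H -> W) : linear F ->
  \tsum_(a, b <- Δ h) (ε a *: F b) = F h.
Proof.
move=> LF; rewrite -{2}(counitl A h) linf_tsum//.
by apply: eq_tsum => a b; rewrite (scalable_linear LF).
Qed.
Lemma sw_counitr W h (F : H -> W) : linear F ->
  \tsum_(a, b <- Δ h) (ε b *: F a) = F h.
Proof.
move=> LF; rewrite -{2}(counitr A h) linf_tsum//.
by apply: eq_tsum => a b; rewrite (scalable_linear LF).
Qed.
Lemma sw_antil W h (F : H -> W) : linear F ->
  \tsum_(a, b <- Δ h) F (S a * b) = ε h *: F 1.
Proof.
move=> LF; rewrite -(linf_tsum (Δ h) (fun a b => S a * b) LF) antipodel.
exact: (scalable_linear LF).
Qed.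
Lemma sw_antir W h (F : H -> W) : linear F ->
  \tsum_(a, b <- Δ h) F (a * S b) = ε h *: F 1.
Proof.
move=> LF; rewrite -(linf_tsum (Δ h) (fun a b => a * S b) LF) antipoder.
exact: (scalable_linear LF).
Qed.
Lemma swM W g h (F : H -> H -> W) : bilin F ->
  tsum (Δ (g * h)) F =
  \tsum_(g1, g2 <- Δ g) \tsum_(h1, h2 <- Δ h) F (g1 * h1) (g2 * h2).
Proof.
move=> BF; rewrite comulM tsum_tsum//; apply: eq_tsum => g1 g2.
by rewrite tsum_tsum//; apply: eq_tsum => h1 h2; rewrite tsum_tens.
Qed.

Lemma sw_cancelr W h (F : H -> H -> W) : bilin F ->
  \tsum_(a, w <- Δ h) \tsum_(b, c <- Δ w) F (a * S b) c = F 1 h.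
Proof.
move=> BF; rewrite -(swA _ (F := fun a b c => F (a * S b) c)); last by split; lin.
under eq_tsum => a b do rewrite (sw_antir _ (proj1 BF b)).
exact: (sw_counitl _ (proj2 BF _)).
Qed.
Lemma antipode1 : S 1 = 1.
Proof.
have := antipodel A 1; rewrite comul1 tsum_tens; last by lin.
by rewrite mulr1 counit1 scale1r.
Qed.

Lemma antipodeM g h : S (g * h) = S h * S g.
Proof.
pose P (g1 g2 g3 h1 h2 h3 : H) : H := S (g1 * h1) * (g2 * h2 * (S h3 * S g3)).
transitivity (\tsum_(g1, g' <- Δ g) \tsum_(g2, g3 <- Δ g')
  \tsum_(h1, h' <- Δ h) \tsum_(h2, h3 <- Δ h') P g1 g2 g3 h1 h2 h3).
  under eq_tsum => g1 g'.
    under eq_tsum => g2 g3.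
      under eq_tsum => h1 h'.
        under eq_tsum => h2 h3 do rewrite /P -(mulrA g2) (mulrA h2).
        rewrite (sw_antir _ (F := fun e => S (g1 * h1) * (g2 * (e * S g3))));
          last by lin.
        rewrite mul1r; over.
      rewrite (sw_counitr _ (F := fun e => S (g1 * e) * (g2 * S g3)));
        last by lin.
      over.
    rewrite (sw_antir _ (F := fun e => S (g1 * h) * e)); last by lin.
    over.
  rewrite (sw_counitr _ (F := fun e => S (e * h) * 1)); last by lin.
  by rewrite mulr1.
rewrite -(swA _ (F := fun g1 g2 g3 => \tsum_(h1, h' <- Δ h)
  \tsum_(h2, h3 <- Δ h') P g1 g2 g3 h1 h2 h3)); last by split; rewrite /P; lin.
under eq_tsum => a g3.
  under eq_tsum => g1 g2.
    rewrite -(swA _ (F := P g1 g2 g3)); last by split; rewrite /P; lin.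
    over.
  rewrite exchange_tsum.
  under eq_tsum => b h3.
    rewrite -(swM a b (F := fun x y => S x * (y * (S h3 * S g3)))); last by lin.
    under eq_tsum => x y do rewrite mulrA.
    rewrite (sw_antil _ (F := fun e => e * (S h3 * S g3))); last by lin.
    rewrite mul1r counitM -scalerA; over.
  rewrite (tsumZ (Δ h) (fun b h3 => ε b *: (S h3 * S g3))) (sw_counitl _ (F := fun e => S e * S g3)); last by lin.
  over.
by rewrite (sw_counitl _ (F := fun e => S h * S e)); last by lin.
Qed.

Fact tmul_bilin : bilin (fun t s : tensor H H =>
  \tsum_(a, b <- t) \tsum_(c, d <- s) (a * c ⊗ b * d)).
Proof. by lin. Qed.
Definition tmul := mkbilin tmul_bilin.

Lemma tmul_tens a b c d : tmul (a ⊗ b) (c ⊗ d) = a * c ⊗ b * d.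
Proof. by rewrite /tmul /= tsum_tens ?tsum_tens//; lin. Qed.

Lemma tmulA : associative tmul.
Proof.
move=> t s r; move: t; apply: tensor_lin_ext; [by lin|by lin|move=> a b].
move: s; apply: tensor_lin_ext; [by lin|by lin|move=> c d].
move: r; apply: tensor_lin_ext; [by lin|by lin|move=> e f].
by rewrite !tmul_tens !mulrA.
Qed.
Lemma tmul1l : left_id (1 ⊗ 1) tmul.
Proof.
apply: tensor_lin_ext; [by lin|by lin|move=> a b].
by rewrite tmul_tens !mul1r.
Qed.
Lemma tmul1r : right_id (1 ⊗ 1) tmul.
Proof.
apply: tensor_lin_ext; [by lin|by lin|move=> a b].
by rewrite tmul_tens !mulr1.
Qed.

Lemma comul_tmul g h : Δ (g * h) = tmul (Δ g) (Δ h).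
Proof. exact: comulM. Qed.

Lemma comul_antipode h : Δ (S h) = \tsum_(a, b <- Δ h) (S b ⊗ S a).
Proof.
pose R (x : H) : tensor H H := \tsum_(a, b <- Δ x) (S b ⊗ S a).
have LR : linear R by rewrite /R; lin.
have RE x : \tsum_(a, b <- Δ x) tmul (Δ a) (R b) = ε x *: (1 ⊗ 1).
  transitivity (\tsum_(a, b <- Δ x) \tsum_(a1, a2 <- Δ a)
      \tsum_(b1, b2 <- Δ b) (a1 * S b2 ⊗ a2 * S b1)).
    apply: eq_tsum => a b; rewrite /tmul /= /R.
    apply: eq_tsum => a1 a2; rewrite tsum_tsum; last by lin.
    by apply: eq_tsum => b1 b2; rewrite tsum_tens//; lin.
  rewrite (swA _ (F := fun a1 a2 b => \tsum_(b1, b2 <- Δ b)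
    (a1 * S b2 ⊗ a2 * S b1))); last by split; lin.
  under eq_tsum => a w.
    rewrite (sw_cancelr _ (F := fun e c => a * S c ⊗ e)); last by lin.
    over.
  by rewrite (sw_antir _ (F := fun e => e ⊗ (1 : H))); last by lin.
transitivity (\tsum_(a, w <- Δ h) \tsum_(b, c <- Δ w)
   tmul (Δ (S a)) (tmul (Δ b) (R c))).
  under eq_tsum => a w.
    rewrite -(linf_tsum (Δ w) (fun b c => tmul (Δ b) (R c))
      (f := fun z => tmul (Δ (S a)) z)); last by lin.
    rewrite RE linearZr tmul1r; over.
  by rewrite (sw_counitr _ (F := fun e => Δ (S e))); last by lin.
rewrite -(swA _ (F := fun a b c => tmul (Δ (S a)) (tmul (Δ b) (R c)))); last by split; lin.
under eq_tsum => d c.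
  under eq_tsum => a b do rewrite tmulA -comul_tmul.
  rewrite (sw_antil _ (F := fun e => tmul (Δ e) (R c))); last by lin.
  rewrite comul1 tmul1l; over.
exact: (sw_counitl _ LR).
Qed.

Lemma sw_antipode W h (F : H -> H -> W) : bilin F ->
  tsum (Δ (S h)) F = \tsum_(a, b <- Δ h) F (S b) (S a).
Proof.
move=> BF; rewrite comul_antipode tsum_tsum//; apply: eq_tsum => a b.
exact: tsum_tens.
Qed.

End HopfTheory.

Record category := Category {
  obj :> Type;
  mor : obj -> obj -> Type;
  idm : forall X, mor X X;
  compm : forall X Y Z, mor Y Z -> mor X Y -> mor X Z;
  compmA : forall X Y Z T (f : mor Z T) (g : mor Y Z) (h : mor X Y),
    compm f (compm g h) = compm (compm f g) h;
  comp1m : forall X Y (f : mor X Y), compm (idm Y) f = f;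
  compm1 : forall X Y (f : mor X Y), compm f (idm X) = f }.
Arguments idm {_} _.

Record functor (C D : category) := Functor {
  fobj :> C -> D;
  fmor : forall X Y : C, mor X Y -> mor (fobj X) (fobj Y);
  fmor1 : forall X, fmor (idm X) = idm (fobj X);
  fmorM : forall (X Y Z : C) (f : mor Y Z) (g : mor X Y),
    fmor (compm f g) = compm (fmor f) (fmor g) }.
Arguments fmor {C D} _ {X Y} _.

Definition idF (C : category) : functor C C :=
  @Functor C C id (fun X Y f => f) (fun X => erefl) (fun X Y Z f g => erefl).

Section CompFunctor.
Variables (C D E : category) (G : functor D E) (F : functor C D).
Fact compF1 X : fmor G (fmor F (idm X)) = idm (G (F X)).
Proof. by rewrite !fmor1. Qed.
Fact compFM (X Y Z : C) (f : mor Y Z) (g : mor X Y) :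
  fmor G (fmor F (compm f g)) = compm (fmor G (fmor F f)) (fmor G (fmor F g)).
Proof. by rewrite !fmorM. Qed.
Definition compF : functor C E :=
  @Functor C E (fun X => G (F X)) (fun X Y f => fmor G (fmor F f)) compF1 compFM.
End CompFunctor.

Definition is_iso (C : category) (X Y : C) (f : mor X Y) : Prop :=
  exists g : mor Y X, compm g f = idm X /\ compm f g = idm Y.

Definition nat_iso (C D : category) (F G : functor C D) : Prop :=
  exists t : forall X : C, mor (F X) (G X),
    (forall X, is_iso (t X)) /\
    (forall (X Y : C) (f : mor X Y),
       compm (t Y) (fmor F f) = compm (fmor G f) (t X)).

Definition is_equivalence (C D : category) (F : functor C D) : Prop :=
  exists G : functor D C, nat_iso (idF C) (compF G F) /\ nat_iso (compF F G) (idF D).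

Section Comodules.
Variables (k : fieldType) (H : algType k) (A : hopf H).
Local Notation Δ := (comul A).
Local Notation ε := (counit A).
Local Notation S := (antipode A).

Record comodule := Comodule {
  comod_sort :> lmodType k;
  coact : {linear comod_sort -> tensor comod_sort H};
  coactA : forall m,
    \tsum_(m0, m1 <- coact m) \tsum_(m00, m01 <- coact m0) (m00 ⊗ (m01 ⊗ m1)) =
    \tsum_(m0, m1 <- coact m) \tsum_(a, b <- Δ m1) (m0 ⊗ (a ⊗ b));
  coact_counit : forall m, \tsum_(m0, m1 <- coact m) (ε m1 *: m0) = m }.

Arguments coact {_}.

Definition regular : comodule := Comodule (comulA A) (counitr A).

Section ComodHom.
Variables (M N : comodule).

Definition colinear : {pred {linear M -> N}} := fun f =>
  `[< forall m, coact (f m) = \tsum_(m0, m1 <- coact m) (f m0 ⊗ m1) >].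

Record comodHom := ComodHom {
  comod_fun :> {linear M -> N};
  _ : comod_fun \in colinear }.

Lemma comodHomP (f : comodHom) m :
  coact (f m) = \tsum_(m0, m1 <- coact m) (f m0 ⊗ m1).
Proof. by case: f => f /= /asboolP. Qed.

HB.instance Definition _ := [isSub for comod_fun].
HB.instance Definition _ := [Choice of comodHom by <:].

Fact colinear_submod : submod_closed colinear.
Proof.
split=> [|a f g /asboolP Hf /asboolP Hg]; apply/asboolP => m /=.
  rewrite linear0; apply/esym/big1 => p _.
  exact: (linear0 (mklin (proj1 (tens_bilin N H) p.2))).
rewrite linearP Hf Hg -tsumZ -tsumD; apply: eq_tsum => u v.
by rewrite (proj1 (tens_bilin N H)).
Qed.
HB.instance Definition _ :=
  GRing.isSubmodClosed.Build k {linear M -> N} colinear colinear_submod.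
HB.instance Definition _ := [SubChoice_isSubLmodule of comodHom by <:].

Lemma comodHom_ext (f g : comodHom) : (forall m, f m = g m) -> f = g.
Proof. by move=> e; apply: val_inj; exact: linear_ext. Qed.

Lemma comodHomPE a (f g : comodHom) m : (a *: f + g) m = a *: f m + g m.
Proof. by []. Qed.

Lemma lin_comodHom (X : lmodType k) (g : X -> comodHom) m :
  linear g -> linear (fun x => g x m).
Proof. by move=> Lg a x y; rewrite Lg. Qed.

End ComodHom.

Fact comod_id_subproof (M : comodule) : (idfun : {linear M -> M}) \in @colinear M M.
Proof. by apply/asboolP => m /=; rewrite -tensor_tsum. Qed.
Definition comod_id M := ComodHom (comod_id_subproof M).

Fact comod_comp_subproof (M N P : comodule) (f : comodHom N P) (g : comodHom M N) :
  (f \o g : {linear M -> P}) \in @colinear M P.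
Proof.
apply/asboolP => m /=; rewrite !comodHomP tsum_tsum; last by lin.
by apply: eq_tsum => u v; rewrite tsum_tens//; lin.
Qed.
Definition comod_comp M N P f g := ComodHom (@comod_comp_subproof M N P f g).

Definition comod_cat : category.
Proof.
by refine (@Category comodule comodHom comod_id comod_comp _ _ _) => *;
  exact: comodHom_ext.
Defined.

(* curry f is u |-> (v |-> f (u ⊗ v)). *)
Section Currying.
Variables (U V W : lmodType k) (f : {linear tensor U V -> W}).
Fact curry_subproof1 u : linear (fun v => f (u ⊗ v)).
Proof. by lin. Qed.
Fact curry_subproof2 : linear (fun u => mklin (curry_subproof1 u)).
Proof.
move=> a x y; apply: linear_ext => v /=.
by rewrite (proj1 (tens_bilin U V)) linearP.
Qed.
Definition curry : {linear U -> {linear V -> W}} := mklin curry_subproof2.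
End Currying.

Fact cscale_subproof (N : lmodType k) (n : N) : linear (fun h => ε h *: n).
Proof. by lin. Qed.
Definition cscale N n := mklin (@cscale_subproof N n).

Record contramodule := Contramodule {
  contra_sort :> lmodType k;
  contract : {linear {linear H -> contra_sort} -> contra_sort};
  contractA : forall f : {linear tensor H H -> contra_sort},
    contract (contract \o curry f) = contract (f \o Δ);
  contract_counit : forall n : contra_sort, contract (cscale n) = n }.

Arguments contract {_}.

Record contraHom (M N : contramodule) := ContraHom {
  contra_fun :> {linear M -> N};
  contraHomP : forall f : {linear H -> M},
    contra_fun (contract f) = contract (contra_fun \o f) }.

Lemma contraHom_ext M N (f g : contraHom M N) : (forall m, f m = g m) -> f = g.
Proof.
case: f g => [f Hf] [g Hg] /= /linear_ext efg; case: _ / efg in Hg *.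
by congr ContraHom; exact: Prop_irrelevance.
Qed.

Fact contra_id_subproof (M : contramodule) (f : {linear H -> M}) :
  (idfun : {linear M -> M}) (contract f) = contract (idfun \o f : {linear H -> M}).
Proof. by rewrite /=; congr (contract _); exact: linear_ext. Qed.
Definition contra_id M := ContraHom (@contra_id_subproof M).

Fact contra_comp_subproof (M N P : contramodule) (f : contraHom N P)
    (g : contraHom M N) (u : {linear H -> M}) :
  (f \o g : {linear M -> P}) (contract u) =
  contract ((f \o g) \o u : {linear H -> P}).
Proof. by rewrite /= !contraHomP; congr (contract _); exact: linear_ext. Qed.
Definition contra_comp M N P f g := ContraHom (@contra_comp_subproof M N P f g).

Definition contra_cat : category.
Proof.
by refine (@Category contramodule contraHom contra_id contra_comp _ _ _) => *;
  exact: contraHom_ext.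
Defined.

End Comodules.
Arguments coact {k H A _}.
Arguments contract {k H A _}.

Section Hat.
Variables (k : fieldType) (H : algType k) (A : hopf H).
Local Notation Δ := (comul A).
Local Notation ε := (counit A).
Local Notation S := (antipode A).

(* Hom(H, M)^H, where H coacts on itself by comultiplication. *)
Definition hat_sort (M : comodule A) : lmodType k := comodHom (regular A) M.

Section HatObject.
Variable M : comodule A.

Lemma hatP (φ : hat_sort M) (h : H) :
  coact (φ h) = \tsum_(a, b <- Δ h) (φ a ⊗ b).
Proof. exact: (comodHomP φ h). Qed.

Fact hat_contract_fun_subproof (θ : {linear H -> hat_sort M}) :
  linear (fun h => \tsum_(h1, h2 <- Δ h) θ h1 h2).
Proof.
apply: lin_tsumt; first by lin.
by split=> [b|a]; [apply: lin_comodHom; lin|lin].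
Qed.
Definition hat_contract_fun θ := mklin (hat_contract_fun_subproof θ).

Fact hat_contract_colinear (θ : {linear H -> hat_sort M}) :
  (hat_contract_fun θ : {linear regular A -> M}) \in @colinear _ _ A (regular A) M.
Proof.
have Lθ x : linear (fun a => θ a x) by apply: lin_comodHom; lin.
apply/asboolP => h /=; rewrite linear_tsum.
under eq_tsum => a b do rewrite hatP.
rewrite -(swA A _ (F := fun a b c => θ a b ⊗ c)); last first.
  by split=> *; [apply: lin_tensl; exact: Lθ|lin|lin].
apply: eq_tsum => a b.
by rewrite (linf_tsum _ _ (f := fun x => x ⊗ b))//; lin.
Qed.
Definition hat_contract_raw θ : hat_sort M := ComodHom (hat_contract_colinear θ).

Fact hat_contract_linear : linear hat_contract_raw.
Proof.
move=> a θ θ'; apply: comodHom_ext => h; rewrite comodHomPE /=.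
by rewrite -tsumZ -tsumD.
Qed.
Definition hat_contract : {linear {linear H -> hat_sort M} -> hat_sort M} :=
  mklin hat_contract_linear.

Fact hat_contractA (f : {linear tensor H H -> hat_sort M}) :
  hat_contract (hat_contract \o curry f) = hat_contract (f \o Δ).
Proof.
apply: comodHom_ext => h /=.
have Lf x : linear (fun t => f t x) by apply: lin_comodHom; lin.
rewrite -(swA A _ (F := fun a b c => f (a ⊗ b) c)); last first.
  by split=> *; [apply: (lin_compf (Lf _)); lin|apply: (lin_compf (Lf _)); lin|lin].
apply: eq_tsum => a b; rewrite [in RHS](tensor_tsum (Δ a)).
by rewrite (linf_tsum _ _ (Lf b)).
Qed.

Fact hat_contract_counit (n : hat_sort M) : hat_contract (cscale A n) = n.
Proof.
apply: comodHom_ext => h /=.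
by rewrite -[RHS](sw_counitl A h (F := n)); last by lin.
Qed.

Definition hat : contramodule A :=
  Contramodule hat_contractA hat_contract_counit.
End HatObject.

Section HatMorphism.
Variables (M N : comodule A) (f : comodHom M N).

Fact hat_map_linear :
  linear (fun φ : hat M => comod_comp f φ : hat N).
Proof. by move=> a φ ψ; apply: comodHom_ext => h /=; rewrite linearP. Qed.
Definition hat_map : {linear hat M -> hat N} := mklin hat_map_linear.

Fact hat_map_contract (θ : {linear H -> hat M}) :
  hat_map (contract θ) = contract (hat_map \o θ).
Proof. by apply: comodHom_ext => h /=; rewrite linear_tsum. Qed.
Definition hat_mor : contraHom (hat M) (hat N) := ContraHom hat_map_contract.
End HatMorphism.

Definition hat_functor : functor (comod_cat A) (contra_cat A).
Proof.
by refine (@Functor (comod_cat A) (contra_cat A) hat hat_mor _ _) => *;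
  apply: contraHom_ext => φ; apply: comodHom_ext.
Defined.

Record is_action (M : lmodType k) (act : {bilinear H -> M -> M}) : Prop :=
  IsAction {
    act1 : forall m, act 1 m = m;
    actM : forall g h m, act (g * h) m = act g (act h m) }.

Definition sw3 (W : lmodType k) (h : H) (F : H -> H -> H -> W) : W :=
  \tsum_(h1, h' <- Δ h) \tsum_(h2, h3 <- Δ h') F h1 h2 h3.

Record aydModule := AydModule {
  ayd_comod :> comodule A;
  ayd_act : {bilinear H -> ayd_comod -> ayd_comod};
  ayd_actP : is_action ayd_act;
  ayd_compat : forall h m, coact (ayd_act h m) =
    sw3 h (fun h1 h2 h3 =>
      \tsum_(m0, m1 <- coact m) (ayd_act h2 m0 ⊗ h3 * m1 * S h1)) }.

Record aydHom (M N : aydModule) := AydHom {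
  ayd_fun :> comodHom M N;
  aydHomP : forall h m, ayd_fun (ayd_act M h m) = ayd_act N h (ayd_fun m) }.

Lemma aydHom_ext M N (f g : aydHom M N) : (forall m, f m = g m) -> f = g.
Proof.
case: f g => [f Hf] [g Hg] /= /comodHom_ext efg; case: _ / efg in Hg *.
by congr AydHom; exact: Prop_irrelevance.
Qed.

Definition ayd_id M : aydHom M M :=
  @AydHom M M (comod_id M) (fun h m => erefl).

Fact ayd_comp_subproof (M N P : aydModule) (f : aydHom N P) (g : aydHom M N) h m :
  comod_comp f g (ayd_act M h m) = ayd_act P h (comod_comp f g m).
Proof. by rewrite /= !aydHomP. Qed.
Definition ayd_comp M N P f g := AydHom (@ayd_comp_subproof M N P f g).

Definition ayd_cat : category.
Proof.
by refine (@Category aydModule aydHom ayd_id ayd_comp _ _ _) => *;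
  exact: aydHom_ext.
Defined.

(* twist h f is the map h^2 f(S(h^3) - h^1). *)
Section Twist.
Variables (N : lmodType k) (act : {bilinear H -> N -> N}).
Fact twist_subproof (h : H) (f : {linear H -> N}) :
  linear (fun x => sw3 h (fun h1 h2 h3 => act h2 (f (S h3 * x * h1)))).
Proof. by rewrite /sw3; lin. Qed.
Definition twist h f : {linear H -> N} := mklin (twist_subproof h f).
End Twist.

Record aydContramodule := AydContramodule {
  aydc_contra :> contramodule A;
  aydc_act : {bilinear H -> aydc_contra -> aydc_contra};
  aydc_actP : is_action aydc_act;
  aydc_compat : forall h (f : {linear H -> aydc_contra}),
    aydc_act h (contract f) = contract (twist aydc_act h f) }.

Record aydcHom (M N : aydContramodule) := AydcHom {
  aydc_fun :> contraHom M N;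
  aydcHomP : forall h m, aydc_fun (aydc_act M h m) = aydc_act N h (aydc_fun m) }.

Lemma aydcHom_ext M N (f g : aydcHom M N) : (forall m, f m = g m) -> f = g.
Proof.
case: f g => [f Hf] [g Hg] /= /contraHom_ext efg; case: _ / efg in Hg *.
by congr AydcHom; exact: Prop_irrelevance.
Qed.

Definition aydc_id M : aydcHom M M :=
  @AydcHom M M (contra_id M) (fun h m => erefl).

Fact aydc_comp_subproof (M N P : aydContramodule) (f : aydcHom N P)
    (g : aydcHom M N) h m :
  contra_comp f g (aydc_act M h m) = aydc_act P h (contra_comp f g m).
Proof. by rewrite /= !aydcHomP. Qed.
Definition aydc_comp M N P f g := AydcHom (@aydc_comp_subproof M N P f g).

Definition aydc_cat : category.
Proof.
by refine (@Category aydContramodule aydcHom aydc_id aydc_comp _ _ _) => *;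
  exact: aydcHom_ext.
Defined.

Section HatAydObject.
Variable M : aydModule.
Local Notation act := (ayd_act M).

Lemma sw_triple (W : lmodType k) (u x v : H) (G : H -> H -> W) : bilin G ->
  tsum (Δ (S u * x * v)) G =
  \tsum_(u1, u2 <- Δ u) \tsum_(x1, x2 <- Δ x) \tsum_(v1, v2 <- Δ v)
    G (S u2 * x1 * v1) (S u1 * x2 * v2).
Proof.
move=> BG; rewrite swM// swM; last by lin.
by rewrite sw_antipode//; lin.
Qed.

Fact hat_act_colinear (h : H) (φ : hat M) :
  (twist act h φ : {linear regular A -> M}) \in @colinear _ _ A (regular A) M.
Proof.
have Lφ : linear (φ : H -> M) by lin.
apply/asboolP => x /=.
rewrite /sw3.
transitivity (\tsum_(x1, x2 <- Δ x) \tsum_(s, w' <- Δ h) \tsum_(q, w4 <- Δ w')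
   (act q (φ (S w4 * x1 * s)) ⊗ x2)); last first.
  apply: eq_tsum => x1 x2; rewrite [RHS](linf_tsum _ _ (f := fun y => y ⊗ x2)); last by lin.
  apply: eq_tsum => s w'; rewrite [RHS](linf_tsum _ _ (f := fun y => y ⊗ x2)) //; lin.
pose F x1 x2 s t p q r u v : tensor M H :=
  act q (φ (S v * x1 * s)) ⊗ (r * (S u * x2 * t) * S p).
transitivity (\tsum_(x1, x2 <- Δ x) \tsum_(h1, w <- Δ h)
  \tsum_(s, t <- Δ h1) \tsum_(h2, h3 <- Δ w) \tsum_(p, w2 <- Δ h2) \tsum_(q, r <- Δ w2)
  \tsum_(u, v <- Δ h3) F x1 x2 s t p q r u v).
  rewrite linear_tsum exchange_tsum; apply: eq_tsum => h1 w.
  rewrite linear_tsum.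
  under [RHS]eq_tsum => x1 x2 do rewrite exchange_tsum.
  rewrite [RHS]exchange_tsum; apply: eq_tsum => h2 h3.
  rewrite ayd_compat /sw3.
  under [RHS]eq_tsum => x1 x2 do rewrite exchange_tsum.
  rewrite [RHS]exchange_tsum; apply: eq_tsum => p w2.
  under [RHS]eq_tsum => x1 x2 do rewrite exchange_tsum.
  rewrite [RHS]exchange_tsum; apply: eq_tsum => q r.
  rewrite hatP tsum_tsum; last by lin.
  under eq_tsum => a b.
    rewrite tsum_tens; last by lin.
    over.
  rewrite [LHS]sw_triple; last by lin.
  rewrite exchange_tsum; apply: eq_tsum => x1 x2.
  by rewrite exchange_tsum.
apply: eq_tsum => x1 x2.
rewrite (swA A _ (F := fun s t w => \tsum_(h2, h3 <- Δ w) \tsum_(p, w2 <- Δ h2)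
  \tsum_(q, r <- Δ w2) \tsum_(u, v <- Δ h3) F x1 x2 s t p q r u v)); last first.
  by split; rewrite /F; lin.
apply: eq_tsum => s w'.
under eq_tsum => t w.
  rewrite (swA A _ (F := fun p w2 h3 => \tsum_(q, r <- Δ w2) \tsum_(u, v <- Δ h3)
    F x1 x2 s t p q r u v)); last by split; rewrite /F; lin.
  over.
pose K e c : tensor M H := \tsum_(w2, h3 <- Δ c) \tsum_(q, r <- Δ w2)
  \tsum_(u, v <- Δ h3) (act q (φ (S v * x1 * s)) ⊗ (r * (S u * x2) * e)).
transitivity (\tsum_(t, w <- Δ w') \tsum_(p, w3 <- Δ w) K (t * S p) w3).
  do 5 (apply: eq_tsum => ? ?); rewrite /F; congr (_ ⊗ _).
  by rewrite !mulrA.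
rewrite (sw_cancelr A _ (F := K)) /K; last by lin.
rewrite (swA A _ (F := fun q r h3 => \tsum_(u, v <- Δ h3)
  (act q (φ (S v * x1 * s)) ⊗ (r * (S u * x2) * 1)))); last by split; lin.
apply: eq_tsum => q w4.
under eq_tsum => r h3 do under eq_tsum => u v do rewrite mulr1 mulrA.
rewrite (sw_cancelr A _ (F := fun e v => act q (φ (S v * x1 * s)) ⊗ (e * x2)));
  last by lin.
by rewrite mul1r.
Qed.

Definition hat_act_raw h (φ : hat M) : hat M := ComodHom (hat_act_colinear h φ).

Fact hat_act_bilin : bilin hat_act_raw.
Proof.
split=> [φ|h] a x y; apply: comodHom_ext => z; rewrite comodHomPE /=.
  pose G t := tsum t (fun h1 h' => \tsum_(h2, h3 <- Δ h') act h2 (φ (S h3 * z * h1))).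
  have LG : linear (fun h => G (Δ h)) by rewrite /G; lin.
  exact: LG.
rewrite /sw3 -tsumZ -tsumD; apply: eq_tsum => h1 h'.
rewrite -tsumZ -tsumD; apply: eq_tsum => h2 h3.
exact: linearPr.
Qed.
Definition hat_act : {bilinear H -> hat M -> hat M} := mkbilin hat_act_bilin.

Fact hat_actP : is_action hat_act.
Proof.
split=> [φ|g h φ]; apply: comodHom_ext => x /=; rewrite /sw3.
  rewrite comul1 tsum_tens; last by lin.
  rewrite comul1 tsum_tens; last by lin.
  by rewrite antipode1 mul1r mulr1 (act1 (ayd_actP M)).
rewrite swM; last by lin.
apply: eq_tsum => g1 g'.
transitivity (\tsum_(h1, h' <- Δ h) \tsum_(g2, g3 <- Δ g') \tsum_(h2, h3 <- Δ h')
  act (g2 * h2) (φ (S (g3 * h3) * x * (g1 * h1)))).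
  by apply: eq_tsum => h1 h'; rewrite swM//; lin.
rewrite exchange_tsum; apply: eq_tsum => g2 g3.
rewrite (linf_tsum _ _ (f := act g2)); last by lin.
apply: eq_tsum => h1 h'; rewrite (linf_tsum _ _ (f := act g2)); last by lin.
apply: eq_tsum => h2 h3.
by rewrite (actM (ayd_actP M)) antipodeM !mulrA.
Qed.

Fact hat_ayd_compat h (θ : {linear H -> hat M}) :
  hat_act h (contract θ) = contract (twist hat_act h θ).
Proof.
apply: comodHom_ext => x /=.
pose T a b : M := θ a b.
have BT : bilin T.
  by split=> [b|a]; rewrite /T; [apply: lin_comodHom; lin|lin].
pose F x1 x2 v1 v2 m u1 u2 : M := act m (T (S u2 * x1 * v1) (S u1 * x2 * v2)).
transitivity (\tsum_(x1, x2 <- Δ x) \tsum_(h1, w <- Δ h) \tsum_(v1, v2 <- Δ h1)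
  \tsum_(m, h3 <- Δ w) \tsum_(u1, u2 <- Δ h3) F x1 x2 v1 v2 m u1 u2).
  rewrite [RHS]exchange_tsum /sw3; apply: eq_tsum => h1 w.
  under [RHS]eq_tsum => x1 x2 do rewrite exchange_tsum.
  rewrite [RHS]exchange_tsum; apply: eq_tsum => m h3.
  rewrite (linf_tsum _ _ (f := act m)); last by lin.
  rewrite (sw_triple h3 x h1 (G := fun a b => act m (T a b))); last by lin.
  rewrite exchange_tsum; apply: eq_tsum => x1 x2.
  by rewrite exchange_tsum.
apply: eq_tsum => x1 x2; apply/esym.
have Lx (y : H) : linear (fun φ : hat M => φ y) by apply: lin_comodHom; lin.
rewrite /sw3 (linf_tsum _ _ (Lx x2)).
under eq_tsum => a w do rewrite (linf_tsum _ _ (Lx x2)) /=.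
rewrite (swA A _ (F := fun v1 v2 w => \tsum_(m, h3 <- Δ w)
  \tsum_(u1, u2 <- Δ h3) F x1 x2 v1 v2 m u1 u2)); last by split; rewrite /F; lin.
apply: eq_tsum => a w.
transitivity (\tsum_(b, c <- Δ w) \tsum_(b1, b' <- Δ b) \tsum_(b2, b3 <- Δ b')
  F x1 x2 a b1 b2 b3 c); first by [].
rewrite (swA A _ (F := fun b1 b' c => \tsum_(b2, b3 <- Δ b')
  F x1 x2 a b1 b2 b3 c)); last by split; rewrite /F; lin.
apply: eq_tsum => b1 w2.
by rewrite (swA A _ (F := fun b2 b3 c => F x1 x2 a b1 b2 b3 c)); last
  by split; rewrite /F; lin.
Qed.

Definition hat_ayd : aydContramodule := AydContramodule hat_actP hat_ayd_compat.
End HatAydObject.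

Fact hat_ayd_mor_subproof (M N : aydModule) (f : aydHom M N) h (φ : hat M) :
  hat_mor f (hat_act M h φ) = hat_act N h (hat_mor f φ).
Proof.
apply: comodHom_ext => x /=; rewrite /sw3 linear_tsum; apply: eq_tsum => h1 h'.
by rewrite linear_tsum; apply: eq_tsum => h2 h3; exact: aydHomP.
Qed.
Definition hat_ayd_mor M N (f : aydHom M N) : aydcHom (hat_ayd M) (hat_ayd N) :=
  @AydcHom (hat_ayd M) (hat_ayd N) (hat_mor f) (@hat_ayd_mor_subproof M N f).

Definition hat_ayd_functor : functor ayd_cat aydc_cat.
Proof.
by refine (@Functor ayd_cat aydc_cat hat_ayd hat_ayd_mor _ _) => *;
  apply: aydcHom_ext => φ; apply: comodHom_ext.
Defined.

End Hat.

(* Main.v *)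
(* A finite-dimensional Hopf algebra with bijective antipode carries a left
   integral lam on H and a right integral L in H with lam (S L) = 1, and
   h |-> (lam (- S h)) and f |-> L1 f(L2) are then mutually inverse.  Hence for
   every comodule M, evaluation phi |-> phi(L) identifies Hom(H, M)^H with M, the
   inverse being m |-> (h |-> lam (m1 S(h)) m0).  So the quasi-inverse can be
   built on the same vector space: a contramodule N becomes a comodule by
   n |-> alpha (x |-> lam (L1 S(x)) n) ⊗ L2, and in the anti-Yetter-Drinfeld case
   the action of H is twisted into chi(h2) h1 n, where chi is the character given
   by h L = chi(h) L.  Evaluation at L is the natural isomorphism on both sides. *)
Require Import Defs.
From mathcomp Require Import all_boot all_algebra falgebra.
From mathcomp Require Import boolp.

Set Implicit Arguments.
Unset Strict Implicit.
Unset Printing Implicit Defensive.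

Import GRing.Theory.
Local Open Scope ring_scope.

(** * Linearity of finite indexed sums *)

Lemma lin_sum (k : fieldType) (I : finType) (X W : lmodType k) (F : I -> X -> W) :
  (forall i, linear (F i)) -> linear (fun x => \sum_i F i x).
Proof.
move=> LF a x y; rewrite scaler_sumr -big_split; apply: eq_bigr => i _.
exact: LF.
Qed.

Ltac lin_sum_step :=
  lazymatch goal with
  | |- GRing.linear_for _ (fun x => \sum_i (@?F i x)) =>
      apply: (@lin_sum _ _ _ _ F)
  | |- _ => lin_step
  end.
Ltac lins := repeat lin_sum_step.

Lemma linf_sum (k : fieldType) (I : finType) (X W : lmodType k) (f : X -> W)
    (F : I -> X) : linear f -> f (\sum_i F i) = \sum_i f (F i).
Proof. by move=> Lf; exact: (linear_sum (mklin Lf)). Qed.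

Lemma sum_tsum (k : fieldType) (I : finType) (U V W : lmodType k)
    (t : tensor U V) (F : I -> U -> V -> W) :
  \sum_i tsum t (F i) = \tsum_(u, v <- t) \sum_i F i u v.
Proof. exact: exchange_big. Qed.

(** * Existence and nondegeneracy of a left integral on H, from a finite dual basis *)

Section Integral.
Variables (k : fieldType) (H : algType k) (A : hopf H).
Local Notation Δ := (comul A).
Local Notation ε := (counit A).
Local Notation S := (antipode A).

Lemma sw_antipode2 (W : lmodType k) h (F : H -> H -> W) : bilin F ->
  tsum (Δ (S (S h))) F = \tsum_(a, b <- Δ h) F (S (S a)) (S (S b)).
Proof. by move=> BF; rewrite !sw_antipode//; lin. Qed.

Lemma counit_antipode h : ε (S h) = ε h.
Proof.
have := sw_antir A h (F := fun e => ε e *: (1 : H)).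
under eq_tsum => a b do rewrite counitM -scalerA.
rewrite (sw_counitl A h (F := fun e => ε (S e) *: (1 : H))); last by lin.
rewrite counit1 scale1r => /(_ (ltac:(by lin))) /(congr1 ε).
by rewrite !linearZ /= counit1 !mulr1.
Qed.

Definition left_integral_on (lam : {scalar H}) : Prop :=
  forall h, \tsum_(a, b <- Δ h) (lam b *: a) = lam h *: 1.

(** Insert [S(x1) x2] before the first leg of [h]; then [x2 h1] and [x3 h2] are the two legs of one
    product, and invariance of [lam] removes the first. *)
Lemma integral_shift (lam : {scalar H}) : left_integral_on lam ->
  forall x h, \tsum_(a, b <- Δ h) (lam (x * b) *: a) =
    \tsum_(x1, x2 <- Δ x) (lam (x2 * h) *: S x1).
Proof.
move=> lamI x h.
transitivity (\tsum_(x1, w <- Δ x) \tsum_(x2, x3 <- Δ w) \tsum_(a, b <- Δ h)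
  (lam (x3 * b) *: (S x1 * (x2 * a)))).
  rewrite -(swA A _ (F := fun x1 x2 x3 => \tsum_(a, b <- Δ h)
    (lam (x3 * b) *: (S x1 * (x2 * a))))); last by split; lin.
  under [RHS]eq_tsum => y x3.
    under eq_tsum => x1 x2.
      under eq_tsum => a b do rewrite mulrA.
      over.
    rewrite (sw_antil A _ (F := fun e => \tsum_(a, b <- Δ h)
      (lam (x3 * b) *: (e * a)))); last by lin.
    over.
  rewrite (sw_counitl A _ (F := fun e => \tsum_(a, b <- Δ h)
    (lam (e * b) *: (1 * a)))); last by lin.
  by apply: eq_tsum => a b; rewrite mul1r.
apply: eq_tsum => x1 w.
rewrite -(swM A w h (F := fun a b => lam b *: (S x1 * a))); last by lin.
under eq_tsum => a b do rewrite scalerAr.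
rewrite -(linf_tsum (Δ (w * h)) (fun a b => lam b *: a) (f := fun e => S x1 * e));
  last by lin.
by rewrite lamI -scalerAr mulr1.
Qed.

Variables (n : nat) (b : 'I_n -> H) (c : 'I_n -> {scalar H}).
Hypothesis bcE : forall x, x = \sum_i c i x *: b i.

Lemma sum_dual_basis (W : lmodType k) (F : H -> W) x :
  linear F -> \sum_i c i x *: F (b i) = F x.
Proof.
move=> LF; rewrite {2}(bcE x) linf_sum//.
by apply: eq_bigr => i _; rewrite (scalable_linear LF).
Qed.

(* The projection of the Hopf module H^* onto its coinvariants maps a functional p
   to p o trace_integral. *)
Definition trace_integral (x : H) : H :=
  \sum_i \tsum_(z1, z2 <- Δ (x * S (S (b i)))) (c i z1 *: z2).
Local Notation R := trace_integral.

Lemma trace_integral_linear : linear R.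
Proof. by rewrite /R; lins. Qed.

(** With [Δ(b_i) = e1 ⊗ e2], each [x1 ⊗ x2 S^2(b_i)] is [Δ(x S^2(e2))] with its first leg multiplied
    on the right by [S(e1)]. Expanding [e2] in the basis and contracting the sum over [i] exchanges
    the two dual bases; a factor [u1 S(u2)] then cancels. *)
Lemma trace_integral_inv x :
  \tsum_(x1, x2 <- Δ x) (x1 ⊗ R x2) = 1 ⊗ R x :> tensor H H.
Proof.
pose F i (a v t : H) : tensor H H := c i v *: (a ⊗ t).
pose K i (a y : H) := \tsum_(z1, z2 <- Δ y) F i a z1 z2.
have BK i : bilin (K i) by rewrite /K /F; lin.
have KR y a : a ⊗ R y = \sum_i K i a (y * S (S (b i))).
  rewrite /R (linf_sum (f := tens a)); last by lin.
  apply: eq_bigr => i _ /=; rewrite (linf_tsum _ _ (f := tens a)); last by lin.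
  apply: eq_tsum => z1 z2; rewrite /F.
  exact: (scalable_linear (proj2 (tens_bilin H H) a)).
transitivity (\sum_i \tsum_(e1, e2 <- Δ (b i))
   \tsum_(u1, u' <- Δ (x * S (S e2))) K i (u1 * S e1) u').
  under eq_tsum => x1 x2 do rewrite KR.
  rewrite -sum_tsum; apply: eq_bigr => i _; apply/esym; have BKi := BK i.
  transitivity (\tsum_(x1, x2 <- Δ x) \tsum_(e1, e2 <- Δ (b i))
     \tsum_(f1, f2 <- Δ e2) K i (x1 * S (e1 * S f1)) (x2 * S (S f2))).
    rewrite exchange_tsum; apply: eq_tsum => e1 e2.
    rewrite swM; last by lin.
    apply: eq_tsum => x1 x2; rewrite sw_antipode2; last by lin.
    by apply: eq_tsum => f1 f2; rewrite antipodeM mulrA.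
  apply: eq_tsum => x1 x2.
  rewrite (sw_cancelr A _ (F := fun e f => K i (x1 * S e) (x2 * S (S f))));
    last by lin.
  by rewrite antipode1 mulr1.
transitivity (\sum_j \sum_i \tsum_(u1, u' <- Δ (x * S (S (b j))))
   \tsum_(u2, u3 <- Δ u') (c i u2 *: \tsum_(e1, e2 <- Δ (b i))
      (c j e2 *: ((u1 * S e1) ⊗ u3)))).
  rewrite exchange_big; apply: eq_bigr => i _; have BKi := BK i.
  under eq_tsum => e1 e2.
    rewrite -(sum_dual_basis (F := fun e => \tsum_(u1, u' <- Δ (x * S (S e)))
      K i (u1 * S e1) u')); last by lin.
    over.
  rewrite -sum_tsum; apply: eq_bigr => j _.
  under eq_tsum => e1 e2 do rewrite -tsumZ.
  rewrite exchange_tsum; apply: eq_tsum => u1 u'.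
  under eq_tsum => e1 e2 do rewrite /K -tsumZ.
  rewrite exchange_tsum; apply: eq_tsum => u2 u3.
  rewrite -tsumZ; apply: eq_tsum => e1 e2.
  by rewrite /F !scalerA mulrC.
rewrite KR; apply: eq_bigr => j _.
rewrite sum_tsum.
transitivity (\tsum_(u1, u' <- Δ (x * S (S (b j)))) \tsum_(e1, w <- Δ u')
   \tsum_(e2, u3 <- Δ w) (c j e2 *: ((u1 * S e1) ⊗ u3))).
  apply: eq_tsum => u1 u'.
  rewrite -(swA A _ (F := fun e1 e2 u3 => c j e2 *: ((u1 * S e1) ⊗ u3)));
    last by split; lin.
  rewrite sum_tsum; apply: eq_tsum => u2 u3.
  rewrite (sum_dual_basis (F := fun e => \tsum_(e1, e2 <- Δ e)
      (c j e2 *: ((u1 * S e1) ⊗ u3))))//; lin.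
by rewrite (sw_cancelr A _ (F := fun e w => \tsum_(e2, u3 <- Δ w)
  (c j e2 *: (e ⊗ u3)))) //; lin.
Qed.

(** Composed with a functional [p], this is the Hopf module identity [p = P(p0) p1], where [P]
    projects onto the coinvariants. The two dual basis sums merge into one sum over the legs of
    [b_i], which the antipode axiom collapses. *)
Lemma trace_integral_recover x :
  \sum_j (\tsum_(r1, r2 <- Δ (R (x * S (b j)))) (c j r1 *: r2)) = x.
Proof.
pose Y i (y : H) : H := \tsum_(z, t <- Δ y) (c i z *: t).
have LY i : linear (Y i) by rewrite /Y; lin.
transitivity (\sum_i \tsum_(e1, e2 <- Δ (b i)) Y i (x * S (S e1 * e2))); last first.
  under eq_bigr => i _.
    have LYi := LY i.
    rewrite (sw_antil A _ (F := fun e => Y i (x * S e))); last by lin.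
    rewrite antipode1 mulr1 /Y -tsumZ; over.
  rewrite sum_tsum -[RHS](sw_counitl A x (@lin_id _ _)); apply: eq_tsum => z t.
  under eq_bigr => i _ do rewrite scalerA mulrC -scalerA.
  by rewrite (sum_dual_basis (F := fun e => ε e *: t))//; lin.
transitivity (\sum_j \sum_l \tsum_(z, t <- Δ (x * S (b j) * S (S (b l))))
   \tsum_(e1, e2 <- Δ z) (c j e2 *: (c l e1 *: t))).
  apply: eq_bigr => j _.
  rewrite -/(Y j _) {1}/R linf_sum//; apply: eq_bigr => l _ /=.
  rewrite (linf_tsum _ _ (LY j)).
  rewrite (swA A _ (F := fun e1 e2 t => c j e2 *: (c l e1 *: t))); last by split; lin.
  apply: eq_tsum => z t; rewrite (scalable_linear (LY j)) /Y /= -tsumZ.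
  by apply: eq_tsum => e1 e2; rewrite !scalerA mulrC.
transitivity (\sum_j \sum_l \sum_i \tsum_(z, t <- Δ (x * S (b j) * S (S (b l))))
   (c i z *: \tsum_(e1, e2 <- Δ (b i)) (c j e2 *: (c l e1 *: t)))).
  apply: eq_bigr => j _; apply: eq_bigr => l _; rewrite sum_tsum.
  apply: eq_tsum => z t; rewrite (sum_dual_basis (F := fun e => \tsum_(e1, e2 <- Δ e)
     (c j e2 *: (c l e1 *: t))))//; lin.
under eq_bigr => j _ do rewrite exchange_big.
rewrite exchange_big; apply: eq_bigr => i _; have LYi := LY i.
under [RHS]eq_tsum => e1 e2.
  rewrite antipodeM mulrA.
  rewrite -(sum_dual_basis (F := fun e => Y i (x * S e * S (S e1)))); last by lin.
  under eq_bigr => j _.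
    rewrite -(sum_dual_basis (F := fun e => Y i (x * S (b j) * S (S e)))); last by lin.
    over.
  over.
rewrite -sum_tsum; apply: eq_bigr => j _.
under [RHS]eq_tsum => e1 e2 do rewrite scaler_sumr.
rewrite -sum_tsum; apply: eq_bigr => l _.
under [RHS]eq_tsum => e1 e2 do rewrite /Y -!tsumZ.
rewrite [RHS]exchange_tsum; apply: eq_tsum => z t.
rewrite -tsumZ; apply: eq_tsum => e1 e2.
by rewrite !scalerA -mulrA mulrC.
Qed.

(** By [trace_integral_inv], any functional composed with [trace_integral] is a left integral. If
    [trace_integral] vanished, [trace_integral_recover] at 1 would give [0 = 1]. *)
Lemma ex_left_integral_on :
  exists2 lam : {scalar H}, left_integral_on lam & exists y, lam y != 0.
Proof.
have [x [i Rx]] : exists x i, c i (R x) != 0.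
  apply: contrapT => nR; have R0 x : R x = 0.
    rewrite (bcE (R x)) big1// => i _; case: (eqVneq (c i (R x)) 0) => [->|ne].
      by rewrite scale0r.
    by case: nR; exists x, i.
  have /eqP := trace_integral_recover 1.
  rewrite big1 ?[0 == 1]eq_sym ?oner_eq0// => j _.
  rewrite R0 linear0.
  by apply: (linear0 (mklin (tsum_linear (b := fun r1 r2 => c j r1 *: r2) _))); lin.
exists (c i \o mklin trace_integral_linear); last by exists x.
move=> h /=.
have B : bilin (fun u v : H => c i v *: u) by lin.
have := congr1 (fun t => tsum t (fun u v => c i v *: u)) (trace_integral_inv h).
rewrite tsum_tsum// tsum_tens// => <-; apply: eq_tsum => u v.
by rewrite tsum_tens.
Qed.

(** By [integral_shift] the sums [lam (x * h2) h1] vanish too. Write [lam y *: h] with [S(h2) h3]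
    inserted after [y]: expanding [y S(h2)] in the basis exhibits it as a sum of linear images of
    such sums. *)
Lemma integral_nondegenerate (lam : {scalar H}) y h : left_integral_on lam ->
  lam y != 0 -> (forall x, lam (x * h) = 0) -> h = 0.
Proof.
move=> lamI ny lamh; apply: (scalerI ny); rewrite scaler0.
have sh0 x : \tsum_(u, v <- Δ h) (lam (x * v) *: u) = 0.
  by rewrite integral_shift//; apply: big1 => p _; rewrite lamh scale0r.
transitivity (\tsum_(h1, w <- Δ h) \tsum_(h2, h3 <- Δ w) (lam (y * (S h2 * h3)) *: h1)).
  under eq_tsum => h1 w.
    rewrite (sw_antil A _ (F := fun e => lam (y * e) *: h1)); last by lin.
    rewrite mulr1; over.
  by rewrite (sw_counitr A _ (F := fun e => lam y *: e))//; lin.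
rewrite -(swA A _ (F := fun h1 h2 h3 => lam (y * (S h2 * h3)) *: h1)); last by split; lin.
pose G i (a : H) := \tsum_(h1, h2 <- Δ a) (c i (y * S h2) *: h1).
have LG i : linear (G i) by rewrite /G; lin.
transitivity (\sum_i G i (\tsum_(u, v <- Δ h) (lam (b i * v) *: u))); last first.
  by apply: big1 => i _; rewrite sh0; exact: (linear0 (mklin (LG i))).
under [RHS]eq_bigr => i _ do rewrite (linf_tsum _ _ (LG i)).
rewrite sum_tsum; apply: eq_tsum => a h3.
under [RHS]eq_bigr => i _ do rewrite (scalable_linear (LG i)) /G /= -tsumZ.
rewrite sum_tsum; apply: eq_tsum => h1 h2.
under eq_bigr => i _ do rewrite scalerA mulrC -scalerA.
by rewrite (sum_dual_basis (F := fun e => lam (e * h3) *: h1)) ?mulrA//; lin.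
Qed.

End Integral.

(** By nondegeneracy and finite dimension every functional has the form [lam (- * l)]; take the [l]
    that represents the counit. Nondegeneracy again makes [l] a left integral, and [L] is its
    preimage under the antipode. *)
Lemma ex_integrals (k : fieldType) (H : falgType k) (A : hopf H) :
  bijective (antipode A) -> exists (lam : {scalar H}) (L : H),
  [/\ left_integral_on A lam, forall h, L * h = counit A h *: L,
      forall h, h * antipode A L = counit A h *: antipode A L
    & lam (antipode A L) = 1].
Proof.
move=> [S' SK S'K].
pose b (i : 'I_(\dim {:H})) : H := (vbasis {:H})`_i.
pose c i : {scalar H} := coord (vbasis {:H}) i.
have bcE x : x = \sum_i c i x *: b i by exact: (coord_vbasis (memvf x)).
have [lam lamI [y ny]] := ex_left_integral_on A bcE.
(* The map [h |-> lam (- * h)] in coordinates, as an endomorphism of H, so that injectivity gives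
   surjectivity. *)
pose f (h : H) := \sum_i lam (b i * h) *: b i.
have Lf : linear f by rewrite /f; lins.
have cf i h : c i (f h) = lam (b i * h).
  exact: (coord_sum_free _ _ (basis_free (vbasisP {:H}))).
have lamE (g : {scalar H}) h : (forall i, lam (b i * h) = g (b i)) ->
    forall x, lam (x * h) = g x.
  move=> e x; rewrite (bcE x) mulr_suml !linear_sum; apply: eq_bigr => i _.
  by rewrite -scalerAl !linearZ /= e.
have kf : lker (linfun (mklin Lf)) == 0%VS.
  rewrite -subv0; apply/subvP => h; rewrite memv_ker memv0 lfunE /= => /eqP fh.
  apply/eqP; apply: (integral_nondegenerate bcE lamI ny).
  by apply: (lamE \0) => i; rewrite -cf fh linear0.
have : \sum_i counit A (b i) *: b i \in limg (linfun (mklin Lf)).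
  by rewrite lker0_limgf// memvf.
move=> /memv_imgP [l _]; rewrite lfunE /= => fl.
have le x : lam (x * l) = counit A x.
  apply: lamE => i; rewrite -cf -fl.
  exact: (coord_sum_free _ _ (basis_free (vbasisP {:H}))).
have li x : x * l = counit A x *: l.
  apply/eqP; rewrite -subr_eq0; apply/eqP.
  apply: (integral_nondegenerate bcE lamI ny) => z.
  rewrite mulrBr mulrA linearB /= le -scalerAr linearZ /= le counitM.
  by rewrite mulrC subrr.
exists lam, (S' l); split=> // [h|h|]; [|by rewrite S'K|by rewrite S'K -[l]mul1r le counit1].
apply: (can_inj SK); rewrite antipodeM S'K li linearZ /= S'K.
by rewrite counit_antipode.
Qed.

(** * The Frobenius structure and the modular function defined by the integrals *)

Section Frobenius.
Variables (k : fieldType) (H : algType k) (A : hopf H).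
Local Notation Δ := (comul A).
Local Notation ε := (counit A).
Local Notation S := (antipode A).

Variables (lam : {scalar H}) (L : H).
Hypothesis lamI : left_integral_on A lam.
Hypothesis LI : forall h, L * h = ε h *: L.
Hypothesis SLI : forall h, h * S L = ε h *: S L.
Hypothesis lamSL : lam (S L) = 1.

(** Mirror image of [integral_shift]: invariance of [lam] at [x S(h1)] creates a factor [x1 S(h2)]
    before [h3], and [S(h2) h3] cancels. *)
Lemma integral_shiftS x h :
  \tsum_(a, b <- Δ x) (lam (b * S h) *: a) =
  \tsum_(h1, h2 <- Δ h) (lam (x * S h1) *: h2).
Proof.
apply/esym.
transitivity (\tsum_(x1, x2 <- Δ x) \tsum_(h', h3 <- Δ h) \tsum_(h1, h2 <- Δ h')
    (lam (x2 * S h1) *: (x1 * (S h2 * h3)))).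
  rewrite exchange_tsum; apply: eq_tsum => h' h3.
  rewrite -[h3 in LHS]mul1r scalerAl -lamI.
  rewrite (linf_tsum _ _ (f := fun e => e * h3)); last by lin.
  rewrite swM; last by lin.
  apply: eq_tsum => x1 x2; rewrite sw_antipode; last by lin.
  by apply: eq_tsum => h1 h2; rewrite -scalerAl mulrA.
apply: eq_tsum => x1 x2.
rewrite (swA A _ (F := fun h1 h2 h3 => lam (x2 * S h1) *: (x1 * (S h2 * h3))));
  last by split; lin.
under eq_tsum => h1 w.
  rewrite (sw_antil A _ (F := fun e => lam (x2 * S h1) *: (x1 * e))); last by lin.
  rewrite mulr1; over.
by rewrite (sw_counitr A _ (F := fun e => lam (x2 * S e) *: x1)); last by lin.
Qed.

(** Together with [integral_dual2], this says that [Δ L] is dual to the form [lam (x * S h)]. The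
    coproduct moves from [L] to [x] by [integral_shiftS], and [S L] absorbs [x2]. *)
Lemma integral_dual1 x : \tsum_(a, b <- Δ L) (lam (x * S a) *: b) = x.
Proof.
rewrite -integral_shiftS.
under eq_tsum => a b do rewrite SLI linearZ /= lamSL mulr1.
exact: counitr.
Qed.

(** In [integral_dual1] at [L], the left factor [L] absorbs [S(L1)], so [lam(L) L = L]; applying
    [lam] after [S] cancels [L]. *)
Lemma integral_lamL : lam L = 1.
Proof.
have := integral_dual1 L.
under eq_tsum => a b do rewrite LI counit_antipode linearZ /= mulrC -scalerA.
rewrite tsumZ counitl => /(congr1 (fun x => lam (S x))).
by rewrite !linearZ /= lamSL mulr1.
Qed.

(** Compute [L1 h1 ⊗ L2 h2 S(h3)] in two ways: cancel [h2 S(h3)], or let [L] absorb the element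
    whose legs are [h1] and [h2]. *)
Lemma integral_slide (W : lmodType k) (F : H -> H -> W) h : bilin F ->
  \tsum_(a, b <- Δ L) F (a * h) b = \tsum_(a, b <- Δ L) F a (b * S h).
Proof.
move=> BF.
transitivity (\tsum_(h1, w <- Δ h) \tsum_(h2, h3 <- Δ w) \tsum_(a, b <- Δ L)
    F (a * h1) (b * (h2 * S h3))).
  under [RHS]eq_tsum => h1 w.
    rewrite (sw_antir A _ (F := fun e => \tsum_(a, b <- Δ L) F (a * h1) (b * e)));
      last by lin.
    over.
  rewrite (sw_counitr A _ (F := fun e => \tsum_(a, b <- Δ L) F (a * e) (b * 1)));
    last by lin.
  by apply: eq_tsum => a b; rewrite mulr1.
rewrite -(swA A _ (F := fun h1 h2 h3 => \tsum_(a, b <- Δ L)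
  F (a * h1) (b * (h2 * S h3)))); last by split; lin.
transitivity (\tsum_(y, h3 <- Δ h) (ε y *: \tsum_(a, b <- Δ L) F a (b * S h3))).
  apply: eq_tsum => y h3.
  have LF : linear (fun e => \tsum_(a, b <- Δ e) F a (b * S h3)) by lin.
  rewrite -(scalable_linear LF) /= -LI swM; last by lin.
  rewrite exchange_tsum; apply: eq_tsum => a b; apply: eq_tsum => h1 h2.
  by rewrite mulrA.
by rewrite (sw_counitl A _ (F := fun e => \tsum_(a, b <- Δ L) F a (b * S e))); last by lin.
Qed.

Lemma integral_dual2 h : \tsum_(a, b <- Δ L) (lam (b * S h) *: a) = h.
Proof.
rewrite -(integral_slide (F := fun a b => lam b *: a)); last by lin.
under eq_tsum => a b do rewrite scalerAl.
rewrite -(linf_tsum (Δ L) (fun a b => lam b *: a) (f := fun e => e * h)); last by lin.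
by rewrite lamI integral_lamL scale1r mul1r.
Qed.

(* L generates H under both the left and the right action of H^*;
   dual_nakayama exchanges the two, see integral_flip. *)
Definition dual_nakayama (x : H) : H := \tsum_(a, b <- Δ L) (lam (a * S x) *: b).
Local Notation D := dual_nakayama.

Lemma dual_nakayama_linear : linear D.
Proof. by rewrite /D; lin. Qed.

Lemma integral_flip (W : lmodType k) (F : H -> H -> W) : bilin F ->
  \tsum_(a, b <- Δ L) F b (D a) = tsum (Δ L) F.
Proof.
move=> BF; rewrite /D.
transitivity (\tsum_(a', b' <- Δ L) \tsum_(a, b <- Δ L) (lam (a' * S a) *: F b b')).
  rewrite exchange_tsum; apply: eq_tsum => a b.
  rewrite (linf_tsum _ _ (proj2 BF b)).
  by apply: eq_tsum => a' b'; rewrite (scalable_linear (proj2 BF b)).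
apply: eq_tsum => a' b'; rewrite -[in RHS](integral_dual1 a').
rewrite (linf_tsum _ _ (proj1 BF b')).
by apply: eq_tsum => a b; rewrite (scalable_linear (proj1 BF b')).
Qed.

(** Two uses of [integral_dual2], on [y] and on a leg of [L], show that [x |-> lam (x * S L2) L1]
    undoes [dual_nakayama]. *)
Lemma dual_nakayamaK y : \tsum_(a, b <- Δ L) (lam (D y * S b) *: a) = y.
Proof.
transitivity (\tsum_(a, b <- Δ L) \tsum_(a', b' <- Δ L)
   (lam (b' * S b) *: (lam (a' * S y) *: a))).
  rewrite exchange_tsum.
  rewrite (linf_tsum (Δ L) (fun a' b' => lam (a' * S y) *: b')
    (f := fun e => \tsum_(a, b <- Δ L) (lam (e * S b) *: a))); last by lin.
  apply: eq_tsum => a' b'; apply: eq_tsum => a b.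
  by rewrite -scalerAl linearZ /= scalerA mulrC.
rewrite -[RHS]integral_dual2; apply: eq_tsum => a b.
have LG : linear (fun e => lam (e * S y) *: a) by lin.
rewrite -[in RHS](integral_dual2 b) (linf_tsum _ _ LG).
by apply: eq_tsum => a' b'; rewrite (scalable_linear LG).
Qed.

(* Hidden behind an opaque existence proof, so that [/=] leaves it alone. *)
Fact ex_modular : {chi : {scalar H} | forall h, chi h = lam (h * L)}.
Proof. by exists (lam \o mklin (lin_mull L (@lin_id _ H))). Qed.
Definition modular : {scalar H} := sval ex_modular.
Local Notation chi := modular.

Lemma modularE h : chi h = lam (h * L).
Proof. exact: (svalP ex_modular). Qed.

Lemma modularP h : h * L = chi h *: L.
Proof.
have [d e] : exists d, h * L = d *: L.
  exists (lam (S L * S h)); rewrite -[LHS]integral_dual2.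
  under eq_tsum => a b.
    rewrite antipodeM mulrA SLI -scalerAl linearZ /= mulrC -scalerA; over.
  by rewrite tsumZ counitr.
by rewrite modularE e linearZ /= integral_lamL mulr1.
Qed.

Lemma modular1 : chi 1 = 1.
Proof. by rewrite modularE mul1r integral_lamL. Qed.

Lemma modularM g h : chi (g * h) = chi g * chi h.
Proof. by rewrite modularE -mulrA modularP -scalerAr linearZ /= -modularE mulrC. Qed.

Lemma sw_modular (W : lmodType k) u (F : H -> H -> W) : bilin F ->
  \tsum_(u1, u2 <- Δ u) \tsum_(a, b <- Δ L) F (u1 * a) (u2 * b) = chi u *: tsum (Δ L) F.
Proof.
move=> BF; rewrite -swM// modularP.
have LF : linear (fun e => tsum (Δ e) F) by apply: lin_tsumt => //; lin.
exact: (scalable_linear LF).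
Qed.

Lemma sw_integralS (W : lmodType k) y (F : H -> H -> W) : bilin F ->
  \tsum_(h1, h2 <- Δ y) \tsum_(a, b <- Δ L) F (a * S h2) (b * S h1) =
  ε y *: tsum (Δ L) F.
Proof.
move=> BF.
have LF : linear (fun e => tsum (Δ e) F) by apply: lin_tsumt => //; lin.
rewrite -(counit_antipode A) -(scalable_linear LF) /= -LI swM//.
by rewrite exchange_tsum sw_antipode//; lin.
Qed.

(* The Nakayama automorphism of lam, expressed through the modular function. *)
Lemma lam_mulC (W : lmodType k) (w : W) h u :
  \tsum_(h1, h2 <- Δ h) (chi h2 *: (lam (u * S (S h1)) *: w)) = lam (h * u) *: w.
Proof.
transitivity (\tsum_(a, b <- Δ L) (lam (u * S a) *: (lam (h * b) *: w))); last first.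
  have LG : linear (fun e => lam (h * e) *: w) by lin.
  rewrite -[in RHS](integral_dual1 u) (linf_tsum _ _ LG).
  by apply: eq_tsum => a b; rewrite (scalable_linear LG).
have LG : linear (fun e => lam (u * S e) *: w) by lin.
transitivity ((fun e => lam (u * S e) *: w) (\tsum_(a, b <- Δ L) (lam (h * b) *: a))).
  rewrite integral_shift// (linf_tsum _ _ LG); apply: eq_tsum => h1 h2.
  by rewrite modularE (scalable_linear LG).
rewrite (linf_tsum _ _ LG); apply: eq_tsum => a b.
by rewrite (scalable_linear LG) /= !scalerA mulrC.
Qed.

End Frobenius.

(** * Linear inverses of morphisms are morphisms, in all four categories *)

Section Inverses.
Variables (k : fieldType) (H : algType k) (A : hopf H).

Section ComodInverse.
Variables (M N : comodule A) (f : comodHom M N) (g : {linear N -> M}).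
Hypotheses (fK : cancel f g) (gK : cancel g f).

Fact comod_inv_colinear : g \in @colinear _ _ A N M.
Proof.
apply/asboolP => n; rewrite -[in RHS](gK n) comodHomP tsum_tsum; last by lin.
rewrite [LHS]tensor_tsum; apply: eq_tsum => u v.
by rewrite tsum_tens ?fK//; lin.
Qed.
Definition comod_inv : comodHom N M := ComodHom comod_inv_colinear.
End ComodInverse.

Section ContraInverse.
Variables (M N : contramodule A) (f : contraHom M N) (g : {linear N -> M}).
Hypotheses (fK : cancel f g) (gK : cancel g f).

Fact contra_inv_contract (u : {linear H -> N}) : g (contract u) = contract (g \o u).
Proof.
apply: (can_inj fK); rewrite gK contraHomP; congr (contract _).
by apply: linear_ext => x /=; rewrite gK.
Qed.
Definition contra_inv : contraHom N M := ContraHom contra_inv_contract.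
End ContraInverse.

Section AydInverse.
Variables (M N : aydModule A) (f : aydHom M N) (g : {linear N -> M}).
Hypotheses (fK : cancel f g) (gK : cancel g f).

Fact ayd_inv_act h n :
  comod_inv fK gK (ayd_act N h n) = ayd_act M h (comod_inv fK gK n).
Proof. by apply: (can_inj fK); rewrite /= gK aydHomP gK. Qed.
Definition ayd_inv : aydHom N M := AydHom ayd_inv_act.
End AydInverse.

Section AydcInverse.
Variables (M N : aydContramodule A) (f : aydcHom M N) (g : {linear N -> M}).
Hypotheses (fK : cancel f g) (gK : cancel g f).

Fact aydc_inv_act h n :
  contra_inv fK gK (aydc_act N h n) = aydc_act M h (contra_inv fK gK n).
Proof. by apply: (can_inj fK); rewrite /= gK aydcHomP gK. Qed.
Definition aydc_inv : aydcHom N M := AydcHom aydc_inv_act.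
End AydcInverse.

End Inverses.

(** * From contramodules to comodules *)

Section InverseFunctor.
Variables (k : fieldType) (H : algType k) (A : hopf H).
Local Notation Δ := (comul A).
Local Notation ε := (counit A).
Local Notation S := (antipode A).

Variables (lam : {scalar H}) (L : H).
Hypothesis lamI : left_integral_on A lam.
Hypothesis LI : forall h, L * h = ε h *: L.
Hypothesis SLI : forall h, h * S L = ε h *: S L.
Hypothesis lamSL : lam (S L) = 1.
Local Notation chi := (modular lam L).
Local Notation D := (dual_nakayama A lam L).

Section UnhatObject.
Variable N : contramodule A.

Fact lam_map_subproof (a c : H) (n : N) : linear (fun x => lam (a * S x * c) *: n).
Proof. by lin. Qed.
(** The factor [c] is 1 in [lam_act]; the action of H later puts [S^2(g3)] there, see
    [act_lam_act]. *)
Definition lam_map a c n := mklin (lam_map_subproof a c n).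

Fact lam_act_bilin : bilin (fun a n => contract (lam_map a 1 n)).
Proof.
split=> [n|a] t x y; rewrite -linearP; congr (contract _);
  apply: linear_ext => z /=; rewrite !mulr1.
  by rewrite mulrDl -scalerAl linearP scalerDl scalerA.
by rewrite scalerDr !scalerA mulrC.
Qed.
(** A contramodule is a module over the convolution algebra of functionals: [f] sends [n] to the
    contraction of [x |-> f(x) n]. Here [f] is [lam (a * S -)]. *)
Definition lam_act : {bilinear H -> N -> N} := mkbilin lam_act_bilin.

(** Contra-associativity yields the convolution product [lam (a' * S x1) lam (a * S x2)], which
    [integral_shiftS] expresses through the coproduct of [a']. *)
Lemma lam_actM a' a n :
  lam_act a' (lam_act a n) = \tsum_(u, v <- Δ a') (lam (a * S u) *: lam_act v n).
Proof.
pose f0 (t : tensor H H) : N := \tsum_(x, y <- t) (lam (a' * S x) *: (lam (a * S y) *: n)).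
have Bf : bilin (fun x y : H => lam (a' * S x) *: (lam (a * S y) *: n)) by lin.
have Lf : linear f0 by exact: tsum_linear.
transitivity (contract (contract \o curry (mklin Lf))).
  congr (contract _); apply: linear_ext => x /=; rewrite mulr1 -linearZ.
  congr (contract _); apply: linear_ext => y /=; rewrite mulr1.
  by rewrite /f0 tsum_tens.
rewrite contractA.
under eq_tsum => u v do rewrite -linearZ.
rewrite -linear_tsum; congr (contract _); apply: linear_ext => x.
have Lx : linear (fun g : {linear H -> N} => g x) by [].
rewrite (linf_tsum _ _ Lx) /= /f0.
have LG : linear (fun e => lam (a * S e) *: n) by lin.
transitivity ((fun e => lam (a * S e) *: n) (\tsum_(x1, x2 <- Δ x) (lam (a' * S x1) *: x2))).
  by rewrite (linf_tsum _ _ LG); apply: eq_tsum => x1 x2; rewrite (scalable_linear LG).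
rewrite -(integral_shiftS lamI).
rewrite (linf_tsum _ _ LG); apply: eq_tsum => u v; rewrite (scalable_linear LG) /=.
by rewrite mulr1 !scalerA mulrC.
Qed.

(** [L] represents the unit of the convolution algebra, as [lam (L * S x) = ε(x)]. *)
Lemma lam_actL n : lam_act L n = n.
Proof.
rewrite -[RHS]contract_counit; congr (contract _); apply: linear_ext => x /=.
by rewrite mulr1 LI counit_antipode linearZ /= (integral_lamL lamI LI SLI lamSL) mulr1.
Qed.

Fact unhat_coact_linear : linear (fun n => \tsum_(a, b <- Δ L) (lam_act a n ⊗ b)).
Proof. by lin. Qed.
Definition unhat_coact : {linear N -> tensor N H} := mklin unhat_coact_linear.

Lemma tsum_unhat_coact (W : lmodType k) n (F : N -> H -> W) : bilin F ->
  tsum (unhat_coact n) F = \tsum_(a, b <- Δ L) F (lam_act a n) b.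
Proof.
by move=> BF; rewrite tsum_tsum//; apply: eq_tsum => a b; rewrite tsum_tens.
Qed.

Fact unhat_coactA n :
  \tsum_(m0, m1 <- unhat_coact n) \tsum_(m00, m01 <- unhat_coact m0) (m00 ⊗ (m01 ⊗ m1)) =
  \tsum_(m0, m1 <- unhat_coact n) \tsum_(a, b <- Δ m1) (m0 ⊗ (a ⊗ b)).
Proof.
rewrite !tsum_unhat_coact; try by lin.
rewrite -(swA A _ (F := fun a b c => lam_act a n ⊗ (b ⊗ c))); last by split; lin.
(* Rotate the three legs of [L], so that the last slot holds [D] of the first leg. On the other side
   [lam_actM] produces the same [D], as the sum of [lam (a * S u) b]. *)
rewrite -[RHS](integral_flip lamI SLI lamSL (F := fun w d =>
  \tsum_(v, b <- Δ w) (lam_act v n ⊗ (b ⊗ d)))); last by lin.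
have LD := dual_nakayama_linear A lam L.
rewrite -(swA A _ (F := fun u v b => lam_act v n ⊗ (b ⊗ D u))); last by split; lin.
transitivity (\tsum_(a', b' <- Δ L) \tsum_(a, b <- Δ L)
   (lam_act a' (lam_act a n) ⊗ (b' ⊗ b))).
  rewrite exchange_tsum; apply: eq_tsum => a b.
  by rewrite tsum_unhat_coact//; lin.
apply: eq_tsum => a' b'.
under eq_tsum => a b.
  rewrite lam_actM (linf_tsum _ _ (f := fun e => e ⊗ (b' ⊗ b))); last by lin.
  over.
rewrite exchange_tsum; apply: eq_tsum => u v.
have LG : linear (fun e : H => lam_act v n ⊗ (b' ⊗ e)) by lin.
rewrite (linf_tsum _ _ LG); apply: eq_tsum => a b.
rewrite (scalable_linear LG).
exact: (scalable_linear (proj1 (tens_bilin N _) (b' ⊗ b))).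
Qed.

Fact unhat_counit n : \tsum_(m0, m1 <- unhat_coact n) (ε m1 *: m0) = n.
Proof.
rewrite tsum_unhat_coact; last by lin.
by rewrite (sw_counitr A _ (F := fun e => lam_act e n)) ?lam_actL//; lin.
Qed.

Definition unhat : comodule A := Comodule unhat_coactA unhat_counit.
End UnhatObject.

Section UnhatMorphism.
Variables (M N : contramodule A) (f : contraHom M N).

Lemma contraHom_lam_map a c n : f (contract (lam_map a c n)) = contract (lam_map a c (f n)).
Proof.
rewrite contraHomP; congr (contract _); apply: linear_ext => x /=.
by rewrite linearZ.
Qed.

Fact unhat_mor_colinear : (f : {linear unhat M -> unhat N}) \in
  @colinear _ _ A (unhat M) (unhat N).
Proof.
apply/asboolP => m; rewrite tsum_unhat_coact; last by lin.
by apply: eq_tsum => a b; rewrite /= contraHom_lam_map.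
Qed.
Definition unhat_mor : comodHom (unhat M) (unhat N) := ComodHom unhat_mor_colinear.
End UnhatMorphism.

Definition unhat_functor : functor (contra_cat A) (comod_cat A).
Proof.
by refine (@Functor (contra_cat A) (comod_cat A) unhat unhat_mor _ _) => *;
  apply: comodHom_ext.
Defined.

(** * Evaluation at the integral [L] and its inverse *)

Section Evaluation.
Variable M : comodule A.

Fact coev_fun_linear (m : M) :
  linear (fun h => \tsum_(m0, m1 <- coact m) (lam (m1 * S h) *: m0)).
Proof. by lin. Qed.
Definition coev_fun m : {linear H -> M} := mklin (coev_fun_linear m).

Lemma comod_swA (W : lmodType k) (m : M) (F : M -> H -> H -> W) :
  (forall b c, linear (fun a => F a b c)) -> (forall a, bilin (F a)) ->
  \tsum_(m0, m1 <- coact m) \tsum_(m00, m01 <- coact m0) F m00 m01 m1 =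
  \tsum_(m0, m1 <- coact m) \tsum_(a, b <- Δ m1) F m0 a b.
Proof.
move=> F1 B2.
have B : bilin (fun a t => tsum t (F a)).
  by split=> [t|a]; [apply: lin_tsum => u v; exact: F1|exact: tsum_linear].
have := congr1 (fun t => tsum t (fun a s => tsum s (F a))) (coactA m).
rewrite !tsum_tsum// => E.
transitivity (\tsum_(m0, m1 <- coact m) tsum (\tsum_(m00, m01 <- coact m0)
   (m00 ⊗ (m01 ⊗ m1))) (fun a s => tsum s (F a))).
  apply: eq_tsum => m0 m1; rewrite tsum_tsum//; apply: eq_tsum => m00 m01.
  by rewrite !tsum_tens.
rewrite E; apply: eq_tsum => m0 m1; rewrite tsum_tsum//; apply: eq_tsum => a b.
by rewrite !tsum_tens.
Qed.

(** Coassociativity moves the second coaction onto [m1], and [integral_shiftS] trades the coproduct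
    of [m1] for that of [h]. *)
Fact coev_colinear m : (coev_fun m : {linear regular A -> M}) \in
  @colinear _ _ A (regular A) M.
Proof.
apply/asboolP => h /=; rewrite linear_tsum.
transitivity (\tsum_(m0, m1 <- coact m) \tsum_(m00, m01 <- coact m0)
   (lam (m1 * S h) *: (m00 ⊗ m01))).
  by apply: eq_tsum => m0 m1; rewrite linearZ /= {1}(tensor_tsum (coact m0)) tsumZ.
rewrite (comod_swA _ (F := fun m0 a b => lam (b * S h) *: (m0 ⊗ a))); last by lin.
  transitivity (\tsum_(m0, m1 <- coact m) \tsum_(h1, h2 <- Δ h)
     (lam (m1 * S h1) *: (m0 ⊗ h2))).
    apply: eq_tsum => m0 m1.
    have LG : linear (fun e : H => m0 ⊗ e) := proj2 (tens_bilin M H) m0.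
    transitivity (m0 ⊗ \tsum_(a, b <- Δ m1) (lam (b * S h) *: a)).
      by rewrite (linf_tsum _ _ LG); apply: eq_tsum => a b; rewrite (scalable_linear LG).
    rewrite (integral_shiftS lamI) (linf_tsum _ _ LG); apply: eq_tsum => a b.
    exact: (scalable_linear LG).
  rewrite exchange_tsum; apply: eq_tsum => h1 h2.
  have LG : linear (fun e : M => e ⊗ h2) := proj1 (tens_bilin M H) h2.
  rewrite (linf_tsum _ _ LG); apply: eq_tsum => m0 m1.
  by rewrite (scalable_linear LG).
by lin.
Qed.
Definition coev_raw m : hat M := ComodHom (coev_colinear m).

Fact coev_linear : linear coev_raw.
Proof.
move=> t x y; apply: comodHom_ext => h; rewrite comodHomPE /=.
have LG : linear (fun m : M => \tsum_(m0, m1 <- coact m) (lam (m1 * S h) *: m0)) by lin.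
exact: LG.
Qed.
Definition coev : {linear M -> hat M} := mklin coev_linear.

Fact ev_linear : linear (fun φ : hat M => φ L).
Proof. by []. Qed.
Definition ev : {linear hat M -> M} := mklin ev_linear.

Lemma evK : cancel ev coev.
Proof.
move=> φ; apply: comodHom_ext => h /=; rewrite hatP tsum_tsum; last by lin.
rewrite -[in RHS](integral_dual2 lamI LI SLI lamSL h) linear_tsum.
apply: eq_tsum => a b; rewrite tsum_tens; last by lin.
by rewrite linearZ.
Qed.

Lemma coevK : cancel coev ev.
Proof.
move=> m /=; rewrite -[RHS](coact_counit m); apply: eq_tsum => m0 m1.
by rewrite SLI linearZ /= lamSL mulr1.
Qed.

(** By [integral_dual1], [lam_act a φ] takes the value [φ a] at [L], so both sides are
    [φ(L1) ⊗ L2]. *)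
Fact ev_colinear : (ev : {linear unhat (hat M) -> M}) \in
  @colinear _ _ A (unhat (hat M)) M.
Proof.
apply/asboolP => φ; rewrite tsum_unhat_coact; last by lin.
rewrite /= hatP; apply: eq_tsum => a b; congr (_ ⊗ _).
rewrite -[in LHS](integral_dual1 lamI SLI lamSL a) linear_tsum.
by apply: eq_tsum => p q; rewrite mulr1 linearZ.
Qed.
Definition ev_comod : comodHom (unhat (hat M)) M := ComodHom ev_colinear.
End Evaluation.

Section EvaluationContra.
Variable N : contramodule A.

(** By [evK], each [θ p q] is determined by the value of [θ p] at [L], hence is a contraction.
    Summed over the legs of [L], its integrand at [y] is [e (θ p')] with [p'] the sum of
    [lam (D y * S q) p], which is [y] by [dual_nakayamaK]. *)
Fact ev_contract (θ : {linear H -> hat (unhat N)}) :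
  (ev (unhat N) : {linear hat (unhat N) -> N}) (contract θ) =
  contract ((ev (unhat N) : {linear hat (unhat N) -> N}) \o θ).
Proof.
set e : {linear hat (unhat N) -> N} := ev (unhat N).
pose G p q : {linear H -> N} :=
  \tsum_(a, b <- Δ L) (lam (b * S q) *: lam_map a 1 (e (θ p))).
transitivity (contract (\tsum_(p, q <- Δ L) G p q)).
  rewrite linear_tsum /= ; apply: eq_tsum => p q.
  rewrite -[θ p in LHS](evK (θ p)) /= tsum_unhat_coact; last by lin.
  rewrite /G linear_tsum; apply: eq_tsum => a b.
  by rewrite linearZ.
congr (contract _); apply: linear_ext => y.
have Ly : linear (fun g : {linear H -> N} => g y) by [].
have Le : linear (fun p => e (θ p)) by lin.
rewrite (linf_tsum _ _ Ly).
transitivity ((fun p => e (θ p)) (\tsum_(p, q <- Δ L) (lam (D y * S q) *: p)));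
  last by rewrite dual_nakayamaK.
rewrite (linf_tsum _ _ Le).
apply: eq_tsum => p q; rewrite (linf_tsum _ _ Ly) (scalable_linear Le).
have LG : linear (fun d => lam (d * S q) *: e (θ p)) by lin.
transitivity ((fun d => lam (d * S q) *: e (θ p)) (D y)); last by [].
rewrite /dual_nakayama (linf_tsum _ _ LG); apply: eq_tsum => a b.
by rewrite (scalable_linear LG) /= mulr1 !scalerA mulrC.
Qed.
Definition ev_contra : contraHom (hat (unhat N)) N := ContraHom ev_contract.
End EvaluationContra.

Lemma hat_functor_equivalence : is_equivalence (hat_functor A).
Proof.
exists unhat_functor; split.
  exists (fun M => comod_inv (evK (M := M)) (coevK (M := M)) (f := ev_comod M)).
  split=> [M|M N f].
    by exists (ev_comod M); split; apply: comodHom_ext => m; [exact: coevK|exact: evK].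
  apply: comodHom_ext => m; apply: (can_inj (@evK _)).
  by rewrite [LHS]coevK; exact/esym/(congr1 f)/coevK.
exists ev_contra; split=> [N|M N f]; last exact: contraHom_ext.
exists (contra_inv (f := ev_contra N) (evK (M := unhat N)) (coevK (M := unhat N))).
by split; apply: contraHom_ext => m; [exact: evK|exact: (coevK (M := unhat N))].
Qed.

(** * The action of H and the anti-Yetter-Drinfeld equivalence *)

Section UnhatAct.
Variables (N : lmodType k) (act : {bilinear H -> N -> N}).

Fact modular_act_bilin :
  bilin (fun h n => \tsum_(h1, h2 <- Δ h) (chi h2 *: act h1 n)).
Proof. by lin. Qed.
Definition modular_act : {bilinear H -> N -> N} := mkbilin modular_act_bilin.

Lemma modular_actP : is_action act -> is_action modular_act.
Proof.
move=> [a1 aM]; split=> [n|g h n] /=.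
  rewrite comul1 tsum_tens; last by lin.
  by rewrite a1 (modular1 lamI LI SLI lamSL) scale1r.
rewrite swM; last by lin.
apply: eq_tsum => g1 g2.
rewrite (linf_tsum _ _ (f := fun e => act g1 e)); last by lin.
rewrite -tsumZ; apply: eq_tsum => h1 h2.
by rewrite aM (modularM lamI LI SLI lamSL) linearZr /= scalerA.
Qed.

(** [L * h1] contributes [ε(h1)] and [S h3 * L] contributes [chi (S h3)]. The factor [chi] in
    [modular_act] is there to cancel this [chi (S h2)]. *)
Lemma twist_integral (f : {linear H -> N}) h :
  twist A act h f L = \tsum_(h1, h2 <- Δ h) (chi (S h2) *: act h1 (f L)).
Proof.
rewrite /twist /= /sw3.
transitivity (\tsum_(h1, w <- Δ h) (ε h1 *: \tsum_(h2, h3 <- Δ w)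
  (chi (S h3) *: act h2 (f L)))).
  apply: eq_tsum => h1 w; rewrite -tsumZ; apply: eq_tsum => h2 h3.
  rewrite -mulrA LI -scalerAr (modularP lamI LI SLI lamSL) !linearZ /=.
  by rewrite !scalerA mulrC.
by rewrite (sw_counitl A _ (F := fun e => \tsum_(h2, h3 <- Δ e)
  (chi (S h3) *: act h2 (f L)))); last by lin.
Qed.

Lemma modular_antil (W : lmodType k) (w : W) h :
  \tsum_(a, b <- Δ h) (chi b *: (chi (S a) *: w)) = ε h *: w.
Proof.
transitivity (\tsum_(a, b <- Δ h) (chi (S a * b) *: w)).
  by apply: eq_tsum => a b; rewrite (modularM lamI LI SLI lamSL) scalerA mulrC.
rewrite (sw_antil A _ (F := fun e => chi e *: w)); last by lin.
by rewrite (modular1 lamI LI SLI lamSL) scale1r.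
Qed.

Lemma modular_antir (W : lmodType k) (w : W) h :
  \tsum_(a, b <- Δ h) (chi (S b) *: (chi a *: w)) = ε h *: w.
Proof.
transitivity (\tsum_(a, b <- Δ h) (chi (a * S b) *: w)).
  by apply: eq_tsum => a b; rewrite (modularM lamI LI SLI lamSL) scalerA mulrC.
rewrite (sw_antir A _ (F := fun e => chi e *: w)); last by lin.
by rewrite (modular1 lamI LI SLI lamSL) scale1r.
Qed.
End UnhatAct.

Section UnhatAydObject.
Variable N : aydContramodule A.
Local Notation act := (aydc_act N).
Local Notation gact := (modular_act act).

Lemma contract_tsum U V (t : tensor U V) (G : U -> V -> {linear H -> N})
    (g : {linear H -> N}) :
  (forall x, tsum t (fun u v => G u v x) = g x) ->
  tsum t (fun u v => contract (G u v)) = contract g.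
Proof.
move=> e; rewrite -linear_tsum; congr (contract _); apply: linear_ext => x.
rewrite -e; exact: (linf_tsum _ _ (f := fun g : {linear H -> N} => g x)).
Qed.

(** The twist puts [S(g3) x g1] in place of [x] in [lam (a * S x)]; the antipode reverses this
    product. *)
Lemma act_lam_act g a (n : N) : act g (lam_act N a n) =
  \tsum_(g1, g' <- Δ g) \tsum_(g2, g3 <- Δ g')
    contract (lam_map (a * S g1) (S (S g3)) (act g2 n)).
Proof.
rewrite [lam_act N a n]/(contract (lam_map a 1 n)) aydc_compat; apply/esym.
under eq_tsum => g1 g' do rewrite -linear_tsum.
apply: contract_tsum => x /=; rewrite /sw3; apply: eq_tsum => g1 g'.
rewrite (linf_tsum _ _ (f := fun g : {linear H -> N} => g x))//.
apply: eq_tsum => g2 g3 /=.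
by rewrite mulr1 !antipodeM linearZr /= !mulrA.
Qed.

(** By [lam_mulC], moving [S^2(g3)] to the left end inside [lam] turns it into [h3] and uses up the
    factor [chi]. *)
Lemma gact_lam_act h a (n : N) : gact h (lam_act N a n) =
  sw3 A h (fun h1 h2 h3 => lam_act N (h3 * a * S h1) (act h2 n)).
Proof.
pose T g1 g2 g3 q : N :=
  chi q *: contract (lam_map (a * S g1) (S (S g3)) (act g2 n)).
have LT1 g2 g3 q : linear (fun g1 => T g1 g2 g3 q).
  rewrite /T; apply: lin_scaler => t x y; rewrite -linearP; congr (contract _).
  apply: linear_ext => z /=.
  by rewrite linearP mulrDr -scalerAr !mulrDl -!scalerAl linearP scalerDl scalerA.
have LT2 g1 g3 q : linear (fun g2 => T g1 g2 g3 q).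
  rewrite /T; apply: lin_scaler => t x y; rewrite -linearP; congr (contract _).
  apply: linear_ext => z /=.
  by rewrite linearPl scalerDr !scalerA mulrC.
have LT3 g1 g2 q : linear (fun g3 => T g1 g2 g3 q).
  rewrite /T; apply: lin_scaler => t x y; rewrite -linearP; congr (contract _).
  apply: linear_ext => z /=.
  by rewrite !linearP !mulrDr -scalerAr linearP scalerDl scalerA.
have LT4 g1 g2 g3 : linear (fun q => T g1 g2 g3 q) by rewrite /T; lin.
transitivity (\tsum_(g, q <- Δ h) \tsum_(g1, g' <- Δ g) \tsum_(g2, g3 <- Δ g')
    T g1 g2 g3 q).
  apply: eq_tsum => g q; rewrite act_lam_act -tsumZ; apply: eq_tsum => g1 g'.
  by rewrite -tsumZ.
rewrite (swA A _ (F := fun g1 g' q => \tsum_(g2, g3 <- Δ g') T g1 g2 g3 q)); last first.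
  by split=> *; lin; [exact: LT1|exact: LT2|exact: LT3|exact: LT4].
rewrite /sw3; apply: eq_tsum => g1 w.
rewrite (swA A _ (F := fun g2 g3 q => T g1 g2 g3 q)); last by split.
apply: eq_tsum => g2 w'.
rewrite /T; under eq_tsum => g3 q do rewrite -linearZ.
apply: contract_tsum => x /=.
by rewrite (lam_mulC lamI SLI lamSL) !mulrA mulr1.
Qed.

(** Starting from the right side, [gact_lam_act] multiplies both legs of [L] on the left by
    consecutive legs of [h], and on the right by antipodes of consecutive legs. The former reduce to
    [chi] by [sw_modular], the latter to [ε] by [sw_integralS]. *)
Fact unhat_ayd_compat h (n : unhat N) : coact (gact h n : unhat N) =
  sw3 A h (fun h1 h2 h3 =>
    \tsum_(m0, m1 <- coact n) ((gact h2 m0 : unhat N) ⊗ h3 * m1 * S h1)).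
Proof.
pose X (h1 g1 g2 g3 h3 : H) : tensor (unhat N) H := \tsum_(a, b <- Δ L)
  (lam_act N (g3 * (a * S g1)) (act g2 n) ⊗ h3 * (b * S h1)).
apply/esym; rewrite /sw3.
transitivity (\tsum_(h1, h' <- Δ h) \tsum_(h2, h3 <- Δ h')
  \tsum_(g1, w <- Δ h2) \tsum_(g2, g3 <- Δ w) X h1 g1 g2 g3 h3).
  apply: eq_tsum => h1 h'; apply: eq_tsum => h2 h3.
  rewrite tsum_unhat_coact; last by lin.
  rewrite /X.
  under [RHS]eq_tsum => g1 w do rewrite exchange_tsum.
  rewrite [RHS]exchange_tsum; apply: eq_tsum => a b.
  rewrite gact_lam_act /sw3.
  rewrite (linf_tsum _ _ (f := fun e : N => (e : unhat N) ⊗ h3 * b * S h1)); last by lin.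
  apply: eq_tsum => g1 w.
  rewrite (linf_tsum _ _ (f := fun e : N => (e : unhat N) ⊗ h3 * b * S h1)); last by lin.
  by apply: eq_tsum => g2 g3; rewrite !mulrA.
pose Y (h1 g1 v : H) : tensor (unhat N) H := \tsum_(g2, u <- Δ v)
  (chi u *: \tsum_(a, b <- Δ L)
  (lam_act N (a * S g1) (act g2 n) ⊗ b * S h1)).
transitivity (\tsum_(h1, h' <- Δ h) \tsum_(g1, v <- Δ h') Y h1 g1 v).
  apply: eq_tsum => h1 h'.
  rewrite (swA A _ (F := fun g1 w h3 => \tsum_(g2, g3 <- Δ w) X h1 g1 g2 g3 h3));
    last by split; rewrite /X; lin.
  apply: eq_tsum => g1 v; rewrite /Y.
  rewrite (swA A _ (F := fun g2 g3 h3 => X h1 g1 g2 g3 h3));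
    last by split; rewrite /X; lin.
  apply: eq_tsum => g2 u; rewrite /X.
  rewrite -(sw_modular lamI LI SLI lamSL u (F := fun a b : H =>
    (lam_act N (a * S g1) (act g2 n) : unhat N) ⊗ b * S h1)); last by lin.
  by do 2 apply: eq_tsum => ? ?; rewrite !mulrA.
(* Regroup so that [h1] and [g1] become the legs of one element [y], as [sw_integralS] requires. *)
rewrite -(swA A _ (F := Y)); last by split; rewrite /Y; lin.
rewrite /Y.
transitivity (\tsum_(y, v <- Δ h) (ε y *: \tsum_(g2, u <- Δ v) (chi u *:
   unhat_coact N (act g2 n)))).
  apply: eq_tsum => y v; rewrite exchange_tsum -tsumZ; apply: eq_tsum => g2 u.
  rewrite tsumZ (sw_integralS LI y (F := fun a b : H =>
    (lam_act N a (act g2 n) : unhat N) ⊗ b)); last by lin.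
  by rewrite !scalerA mulrC.
rewrite (sw_counitl A _ (F := fun v => \tsum_(g2, u <- Δ v) (chi u *:
   unhat_coact N (act g2 n)))); last by lin.
rewrite [RHS]linear_tsum; apply: eq_tsum => g2 u.
by rewrite linearZ.
Qed.

Definition unhat_ayd : aydModule A :=
  @AydModule _ _ _ (unhat N) gact (modular_actP (aydc_actP N)) unhat_ayd_compat.
End UnhatAydObject.

Fact unhat_ayd_mor_act (M N : aydContramodule A) (f : aydcHom M N) h m :
  unhat_mor f (ayd_act (unhat_ayd M) h m) = ayd_act (unhat_ayd N) h (unhat_mor f m).
Proof.
rewrite /= linear_tsum; apply: eq_tsum => h1 h2.
by rewrite linearZ /= aydcHomP.
Qed.
Definition unhat_ayd_mor M N (f : aydcHom M N) :
    aydHom (unhat_ayd M) (unhat_ayd N) :=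
  @AydHom _ _ _ (unhat_ayd M) (unhat_ayd N) (unhat_mor f) (unhat_ayd_mor_act f).

Definition unhat_ayd_functor : functor (aydc_cat A) (ayd_cat A).
Proof.
by refine (@Functor (aydc_cat A) (ayd_cat A) unhat_ayd unhat_ayd_mor _ _) => *;
  apply: aydHom_ext.
Defined.

(** The [chi] of [modular_act] meets the [chi] after [S] of [twist_integral]; they are convolution
    inverse. *)
Fact ev_comod_act (M : aydModule A) h φ :
  ev_comod M (ayd_act (unhat_ayd (hat_ayd M)) h φ) = ayd_act M h (ev_comod M φ).
Proof.
transitivity (\tsum_(h1, h2 <- Δ h) (chi h2 *: ev M (hat_act M h1 φ))).
  by rewrite /= (linf_tsum _ _ (ev_linear (M := M))).
have E h1 : ev M (hat_act M h1 φ) = twist A (ayd_act M) h1 φ L by [].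
under eq_tsum => h1 h2 do rewrite E twist_integral -tsumZ.
rewrite (swA A _ (F := fun g q h2 => chi h2 *: (chi (S q) *: ayd_act M g (φ L))));
  last by split; lin.
under eq_tsum => g w do rewrite modular_antil.
by rewrite (sw_counitr A _ (F := fun e => ayd_act M e (φ L)))//; lin.
Qed.
Definition ev_ayd (M : aydModule A) : aydHom (unhat_ayd (hat_ayd M)) M :=
  @AydHom _ _ _ (unhat_ayd (hat_ayd M)) M (ev_comod M) (@ev_comod_act M).

Fact ev_contra_act (N : aydContramodule A) h φ :
  ev_contra N (aydc_act (hat_ayd (unhat_ayd N)) h φ) = aydc_act N h (ev_contra N φ).
Proof.
transitivity (twist A (ayd_act (unhat_ayd N)) h φ L); first by [].
rewrite twist_integral.
transitivity (\tsum_(h1, h2 <- Δ h) \tsum_(g, q <- Δ h1)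
  (chi (S h2) *: (chi q *: aydc_act N g (ev_contra N φ)))).
  by apply: eq_tsum => h1 h2; rewrite tsumZ.
rewrite (swA A _ (F := fun g q h2 =>
  chi (S h2) *: (chi q *: aydc_act N g (ev_contra N φ)))); last by split; lin.
under eq_tsum => g w do rewrite modular_antir.
by rewrite (sw_counitr A _ (F := fun e => aydc_act N e (ev_contra N φ)))//; lin.
Qed.
Definition ev_aydc (N : aydContramodule A) : aydcHom (hat_ayd (unhat_ayd N)) N :=
  @AydcHom _ _ _ (hat_ayd (unhat_ayd N)) N (ev_contra N) (@ev_contra_act N).

Lemma hat_ayd_functor_equivalence : is_equivalence (hat_ayd_functor A).
Proof.
exists unhat_ayd_functor; split.
  exists (fun M => ayd_inv (evK (M := M)) (coevK (M := M)) (f := ev_ayd M)).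
  split=> [M|M N f].
    by exists (ev_ayd M); split; apply: aydHom_ext => m; [exact: coevK|exact: evK].
  apply: aydHom_ext => m; apply: (can_inj (@evK _)).
  by rewrite [LHS]coevK; exact/esym/(congr1 f)/coevK.
exists ev_aydc; split=> [N|M N f]; last exact: aydcHom_ext.
exists (aydc_inv (f := ev_aydc N) (evK (M := unhat N)) (coevK (M := unhat N))).
by split; apply: aydcHom_ext => m; [exact: evK|exact: (coevK (M := unhat N))].
Qed.

End InverseFunctor.

Theorem proposition4p4 (k : fieldType) (char0 : [pchar k] =i pred0)
    (H : falgType k) (A : hopf H) (bijS : bijective (antipode A)) :
  is_equivalence (hat_functor A) /\ is_equivalence (hat_ayd_functor A).
Proof.
have [lam [L [lamI LI SLI lamSL]]] := ex_integrals bijS; split.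
  exact: hat_functor_equivalence lamI LI SLI lamSL.
exact: hat_ayd_functor_equivalence lamI LI SLI lamSL.
Qed.
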